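(* As formal power series in $y$ and $w$, $$B(y^2,w)=\sum_{n\ge 1}\sum_{p=1}^{2n} B_{n,p}\, y^{2n} w^p = \int_0^\infty dt \,e^{-t}\,\frac{1}{2\pi i}\oint_{|x|=\epsilon} \frac{dx}{x}\, e^{x^2/2}\,\mathcal{L}\left(\frac{t}{x},\,w,\,\frac{ix}{t},\,y\right),$$ that is, the right-hand side is the generating function which counts the numbers $B_{n,p}$.
   Context: A linear chord diagram on $2n$ vertices is a perfect matching of the linearly ordered set of vertices $\{1,2,\dots,2n\}$; its $n$ pairs are called chords. A short chord is a chord joining two adjacent vertices $i,i+1$. A bubble of a linear chord diagram is a nonempty maximal set of consecutive vertices none of which is an endpoint of a short chord (so a bubble is bounded on each side by a short chord or by an end of the diagram; its vertices may be joined by non-short chords to one another or to vertices outside the bubble). The size of a bubble is the number of its vertices. $B_{n,p}$ denotes the total number of bubbles of size $p$, counted across all $(2n-1)!!$ linear chord diagrams on $2n$ vertices, and $B(y,w)=\sum_{n,p}B_{n,p}\,y^n w^p$. Define $$L(x,y)=\frac{1}{1-y(1+x^2y)},\qquad \mathcal{L}(r,w,x,y)=\frac{1}{1-y^2L(x,ry)}\Bigl(L(x,wry)-1\Bigr)\frac{1}{1-y^2L(x,ry)}.$$ The identity is formal: $\mathcal{L}(t/x,w,ix/t,y)$ is expanded as a power series in $y$ (whose coefficients are polynomials in $w$, $t$, $x$ and $x^{-1}$), and the contour integral over the circle $|x|=\epsilon$ ($\epsilon>0$, counterclockwise) and the integral over $t$ are applied term by term to the coefficient of each monomial $y^m w^p$.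 Here $i$ is the imaginary unit. *)

(* Defs.v *)
(* MathComp-Analysis: the real numbers are any [R : realType], the complex
   numbers are [R[i]]. *)
From HB Require Import structures.
From mathcomp Require Import all_boot all_order all_algebra.
From mathcomp Require Import all_classical all_reals all_analysis.
From mathcomp Require Import complex.

Set Implicit Arguments.
Unset Strict Implicit.
Unset Printing Implicit Defensive.

Import Order.TTheory GRing.Theory Num.Theory.

Local Open Scope ring_scope.

(* Vertices are numbered from 0, so [2n] vertices are the elements of
   ['I_(2 * n)]; a diagram is the set of its chords. *)
Definition chord_diagrams (n : nat) : {set {set {set 'I_(2 * n)}}} :=
  [set D | finset.partition D [set: 'I_(2 * n)] & [forall c in D, #|c| == 2%N]].

Definition short_chord (N : nat) (c : {set 'I_N}) : bool :=
  [exists i : 'I_N, exists j : 'I_N,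
     (val j == (val i).+1) && (c == [set i; j])].

Definition on_short_chord (N : nat) (D : {set {set 'I_N}}) (v : 'I_N) : bool :=
  [exists c in D, short_chord c && (v \in c)].

Definition consecutive (N : nat) (A : {set 'I_N}) : bool :=
  [forall i in A, forall j in A, forall k : 'I_N,
     (i <= k <= j)%N ==> (k \in A)].

Definition bubbles (N : nat) (D : {set {set 'I_N}}) : {set {set 'I_N}} :=
  [set A | (A != finset.set0) &&
     maxset (fun A' : {set 'I_N} =>
               consecutive A' && [forall v in A', ~~ on_short_chord D v]) A].

Definition bubble_count (n p : nat) : nat :=
  (\sum_(D in chord_diagrams n) #|[set A in bubbles D | #|A| == p]|)%N.

(* Formal power series in one variable.  A record rather than an alias of
   [nat -> K], on which the library's ring operations are pointwise. *)
Record fps (K : Type) : Type := Fps { fps_coef : nat -> K }.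
Coercion fps_coef : fps >-> Funclass.

HB.instance Definition _ (K : Type) := gen_eqMixin (fps K).
HB.instance Definition _ (K : Type) := gen_choiceMixin (fps K).

Lemma fpsP (K : Type) (f g : fps K) : (forall m, f m = g m) <-> f = g.
Proof.
split=> [fg|->//]; case: f g fg => f [g] /= fg; congr Fps.
exact: boolp.funext.
Qed.

Definition fps_zero (K : zmodType) : fps K := Fps (fun=> 0).
Definition fps_opp (K : zmodType) (f : fps K) : fps K := Fps (fun m => - f m).
Definition fps_add (K : zmodType) (f g : fps K) : fps K :=
  Fps (fun m => f m + g m).

Fact fps_addA (K : zmodType) : associative (@fps_add K).
Proof. by move=> f g h; apply/fpsP => m /=; rewrite addrA. Qed.
Fact fps_addC (K : zmodType) : commutative (@fps_add K).
Proof. by move=> f g; apply/fpsP => m /=; rewrite addrC. Qed.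
Fact fps_add0 (K : zmodType) : left_id (@fps_zero K) (@fps_add K).
Proof. by move=> f; apply/fpsP => m /=; rewrite add0r. Qed.
Fact fps_addN (K : zmodType) :
  left_inverse (@fps_zero K) (@fps_opp K) (@fps_add K).
Proof. by move=> f; apply/fpsP => m /=; rewrite addNr. Qed.

HB.instance Definition _ (K : zmodType) := GRing.isZmodule.Build (fps K)
  (@fps_addA K) (@fps_addC K) (@fps_add0 K) (@fps_addN K).

Definition fpsC (K : nzRingType) (c : K) : fps K :=
  Fps (fun m => if m == 0%N then c else 0).
Definition fpsX (K : nzRingType) : fps K := Fps (fun m => (m == 1%N)%:R).
Definition fps_mul (K : nzRingType) (f g : fps K) : fps K :=
  Fps (fun m => \sum_(i < m.+1) f i * g (m - i)%N).

Definition fps_trunc (K : nzRingType) (N : nat) (f : fps K) : {poly K} :=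
  \poly_(i < N) f i.

Fact fps_mul_trunc (K : nzRingType) (f g : fps K) (N m : nat) : (m < N)%N ->
  fps_mul f g m = (fps_trunc N f * fps_trunc N g)`_m.
Proof.
move=> mN; rewrite coefM /=; apply: eq_bigr => i _.
by rewrite !coef_poly !(leq_ltn_trans _ mN) ?leq_subr// -ltnS.
Qed.

Fact fps_mulA (K : comNzRingType) : associative (@fps_mul K).
Proof.
move=> f g h; apply/fpsP => m.
transitivity ((fps_trunc m.+1 f * (fps_trunc m.+1 g * fps_trunc m.+1 h))`_m).
  rewrite coefM [LHS]/=; apply: eq_bigr => i _.
  rewrite coef_poly ltn_ord -fps_mul_trunc//.
  by rewrite ltnS leq_subr.
rewrite mulrA coefM [RHS]/=; apply: eq_bigr => i _.
by rewrite coef_poly ltnS leq_subr -fps_mul_trunc.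
Qed.
Fact fps_mulC (K : comNzRingType) : commutative (@fps_mul K).
Proof.
by move=> f g; apply/fpsP => m; rewrite !(fps_mul_trunc _ _ (ltnSn m)) mulrC.
Qed.
Fact fps_mul1 (K : comNzRingType) : left_id (fpsC (1 : K)) (@fps_mul K).
Proof.
move=> f; apply/fpsP => m /=.
by rewrite big_ord_recl big1 ?addr0 ?mul1r ?subn0// => i _; rewrite mul0r.
Qed.
Fact fps_mulDl (K : comNzRingType) :
  left_distributive (@fps_mul K) (@fps_add K).
Proof.
move=> f g h; apply/fpsP => m /=; rewrite -big_split/=.
by apply: eq_bigr => i _; rewrite mulrDl.
Qed.
Fact fps_1neq0 (K : comNzRingType) : fpsC (1 : K) != @fps_zero K.
Proof. by apply/eqP => /fpsP/(_ 0%N)/= /eqP; rewrite oner_eq0. Qed.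

HB.instance Definition _ (K : comNzRingType) :=
  GRing.Zmodule_isComNzRing.Build (fps K) (@fps_mulA K) (@fps_mulC K)
    (@fps_mul1 K) (@fps_mulDl K) (@fps_1neq0 K).

Lemma fpsD_coef (K : zmodType) (f g : fps K) m : (f + g) m = f m + g m.
Proof. by []. Qed.
Lemma fpsN_coef (K : zmodType) (f : fps K) m : (- f) m = - f m.
Proof. by []. Qed.
Lemma fps1_coef (K : comNzRingType) m : (1 : fps K) m = (m == 0%N)%:R.
Proof. by rewrite -[LHS]/(if _ then _ else _); case: eqP. Qed.
Lemma fpsM_coef (K : comNzRingType) (f g : fps K) m :
  (f * g) m = \sum_(i < m.+1) f i * g (m - i)%N.
Proof. by []. Qed.
Lemma fpsCM_coef (K : comNzRingType) c (f : fps K) m :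
  (fpsC c * f) m = c * f m.
Proof.
rewrite fpsM_coef big_ord_recl big1 ?addr0 ?subn0// => i _.
by rewrite /= mul0r.
Qed.

Definition fps_unit (K : comUnitRingType) : {pred fps K} :=
  [pred f : fps K | f 0%N \is a GRing.unit].

(* With [c = 1 / f(0)], the inverse is [c] times the geometric series of
   [1 - c f], which has no constant term: the powers beyond the [m]-th do not
   contribute to the [m]-th coefficient. *)
Definition fps_inv (K : comUnitRingType) (f : fps K) : fps K :=
  if f 0%N \is a GRing.unit then
    Fps (fun m => (fpsC (f 0%N)^-1 *
                   \sum_(k < m.+1) (1 - fpsC (f 0%N)^-1 * f) ^+ k) m)
  else f.

Fact fps_exp_coef0 (K : comNzRingType) (u : fps K) k m :
  u 0%N = 0 -> (m < k)%N -> (u ^+ k) m = 0.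
Proof.
move=> u0; elim: k m => // k IH m mk; rewrite exprS fpsM_coef.
apply: big1 => -[[|i] im] _ /=; first by rewrite u0 mul0r.
rewrite IH ?mulr0//; case: m im mk => // m _ mk; rewrite subSS.
by rewrite (leq_ltn_trans (leq_subr _ _)).
Qed.

Fact fps_sum_coef (K : comNzRingType) N (F : nat -> fps K) m :
  (\sum_(k < N) F k) m = \sum_(k < N) F k m.
Proof. by elim: N => [|N IH]; rewrite ?big_ord0// !big_ord_recr/= -IH. Qed.

Fact fps_mulV (K : comUnitRingType) :
  {in @fps_unit K, left_inverse 1 (@fps_inv K) *%R}.
Proof.
move=> f; rewrite inE => uf; apply/fpsP => m; rewrite /fps_inv uf.
set c := fpsC _; set u := 1 - c * f; have u0 : u 0%N = 0.
  by rewrite fpsD_coef fpsN_coef fpsCM_coef fps1_coef mulVr// subrr.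
transitivity ((c * (\sum_(k < m.+1) u ^+ k) * f) m).
  rewrite !fpsM_coef; apply: eq_bigr => -[i im] _; congr (_ * _).
  rewrite -[LHS]/((c * \sum_(k < i.+1) u ^+ k) i) !fpsCM_coef; congr (_ * _).
  rewrite !fps_sum_coef (big_ord_widen_cond m.+1 xpredT (fun k => (u ^+ k) i))//.
  rewrite [RHS](bigID (fun k : 'I_m.+1 => k < i.+1)%N)/=.
  rewrite [X in _ = _ + X]big1 ?addr0//.
  by move=> k; rewrite -leqNgt => ik; rewrite fps_exp_coef0.
have -> : c * (\sum_(k < m.+1) u ^+ k) * f = 1 - u ^+ m.+1.
  rewrite -[RHS]opprB subrX1 -mulNr opprB mulrAC; congr (_ * _).
  by rewrite /u opprB addrCA subrr addr0.
by rewrite fpsD_coef fpsN_coef fps_exp_coef0// subr0.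
Qed.

Fact fps_unitPl (K : comUnitRingType) (f g : fps K) :
  g * f = 1 -> fps_unit f.
Proof.
move=> /fpsP/(_ 0%N); rewrite fpsM_coef fps1_coef big_ord1 /= => gf1.
by apply/unitrPr; exists (g 0%N); rewrite mulrC.
Qed.

Fact fps_inv_out (K : comUnitRingType) :
  {in [predC @fps_unit K], @fps_inv K =1 id}.
Proof.
by move=> f; rewrite !inE /fps_inv => nuf; rewrite ifN.
Qed.

HB.instance Definition _ (K : comUnitRingType) :=
  GRing.ComNzRing_hasMulInverse.Build (fps K) (@fps_mulV K) (@fps_unitPl K)
    (@fps_inv_out K).

(* [fps (fps K)] is the ring of series in [y] and [w]: a series in [y] whose
   coefficients are series in [w], [f m p] being the coefficient of
   [y ^ m * w ^ p] in [f]. *)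
Definition fps2_of (K : Type) (a : nat -> nat -> K) : fps (fps K) :=
  Fps (fun m => Fps (fun p => a m p)).
Definition fps_subst_sqr (K : zmodType) (f : fps K) : fps K :=
  Fps (fun m => if odd m then 0 else f m./2).

Definition Lser (A : unitRingType) (x y : A) : A :=
  (1 - y * (1 + x ^+ 2 * y))^-1.
Definition calL (A : unitRingType) (r w x y : A) : A :=
  (1 - y ^+ 2 * Lser x (r * y))^-1 * (Lser x (w * r * y) - 1) *
  (1 - y ^+ 2 * Lser x (r * y))^-1.

Definition expC (R : realType) (z : R[i]) : R[i] :=
  ((expR (complex.Re z) * cos (complex.Im z))
   +i* (expR (complex.Re z) * sin (complex.Im z)))%C.
Definition Cintegrable (R : realType) (D : set R) (f : R -> R[i]) : Prop :=
  (@lebesgue_measure R).-integrable D (fun u => (complex.Re (f u))%:E) /\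
  (@lebesgue_measure R).-integrable D (fun u => (complex.Im (f u))%:E).
Definition Cintegral (R : realType) (D : set R) (f : R -> R[i]) : R[i] :=
  ((\int[@lebesgue_measure R]_(u in D) complex.Re (f u))
   +i* (\int[@lebesgue_measure R]_(u in D) complex.Im (f u)))%C.

Definition circle (R : realType) (e : R) (theta : R) : R[i] :=
  e%:C%C * expC ('i%C * theta%:C%C).
(* [f(x) dx] pulled back along [x = circle e theta], where
   [dx = 'i * x * dtheta]. *)
Definition circle_pullback (R : realType) (e : R) (f : R[i] -> R[i])
    (theta : R) : R[i] :=
  f (circle e theta) * ('i%C * circle e theta).
Definition circle_integral (R : realType) (e : R) (f : R[i] -> R[i]) : R[i] :=
  Cintegral `[0, 2 * pi]%classic (circle_pullback e f).

(* [calL (t / x) w ('i * x / t) y] for numbers [t] and [x] and formal variables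
   [w] and [y]: its coefficients are the values at [t] and [x] of polynomials in
   [t / x]; the convention [z / 0 = 0] makes it meaningless at [t = 0] or
   [x = 0], which the domains of integration below avoid. *)
Definition calL_at (R : realType) (t : R) (x : R[i]) : fps (fps R[i]) :=
  calL (fpsC (fpsC (t%:C%C / x))) (fpsC (fpsX R[i]))
    (fpsC (fpsC ('i%C * x / t%:C%C))) (fpsX (fps R[i])).
Definition contour_integrand (R : realType) (m p : nat) (t : R) (x : R[i]) :
    R[i] :=
  x^-1 * expC (x ^+ 2 / 2) * calL_at t x m p.
Definition laplace_integrand (R : realType) (e : R) (m p : nat) (t : R) :
    R[i] :=
  (expR (- t))%:C%C *
  ((2 * (pi : R)%:C%C * 'i%C)^-1 * circle_integral e (contour_integrand m p t)).
Definition integral_series (R : realType) (e : R) : fps (fps R[i]) :=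
  fps2_of (fun m p => Cintegral `]0, +oo[%classic (laplace_integrand e m p)).

(* Main.v *)
Require Import Defs.
From mathcomp Require Import all_boot all_order all_algebra.
From mathcomp Require Import all_classical all_reals all_analysis.
From mathcomp Require Import measurable_realfun.
From mathcomp Require Import complex.
From mathcomp Require Import zify ring lra.

Set Implicit Arguments.
Unset Strict Implicit.
Unset Printing Implicit Defensive.

Import Order.TTheory GRing.Theory Num.Theory.

Local Open Scope ring_scope.

(** Write [z] for [t / x].  At the arguments of the theorem the two series [L]
    are [1 / (1 - z y + y^2)] and [1 / (1 - z w y + w^2 y^2)], so that their
    coefficients are the Chebyshev polynomials [U_n] of the second kind,
    normalized by [U_1 = z], and [1 / (1 - y^2 L)] collapses to
    [G = 1 + y^2 / (1 - z y)].  The coefficient of [y^m w^p] in the integrand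
    is therefore a polynomial in [z], the sum over [b] of
    [G_(b-p) U_p G_(m-b)] ([calL_fps_coef]).

    The contour integral replaces [z^k] by [t^k] times the [k]-th Taylor
    coefficient of [exp (x^2 / 2)], and the Laplace integral replaces [t^k] by
    [k!]; together they replace [z^k] by [(k-1)!!] for even [k] and by [0] for
    odd [k].  This is the number of perfect matchings of [k] points, so both
    integrals amount to the linear functional [moment] on polynomials
    ([laplace_integral_moment]).

    It remains to see that [moment] turns the polynomial above into a number of
    bubbles.  The recurrence [U_(n+2) = z U_(n+1) - U_n] is inclusion and
    exclusion on the first edge of a path: [moment (z^q U_p)] counts the
    matchings of [q + p] points in which no two neighbours on a path through
    [p] of the points are matched ([card_matchings_avoids]).  In a diagram on
    [m] vertices, the vertices [a, ..., b-1] form a bubble exactly when no two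
    neighbours among them are matched and, on each side where the diagram goes
    on, the next two vertices form a short chord ([bubbles_runE]).  Deleting
    these chords leaves [a - 2] and [m - b - 2] unconstrained vertices, which is
    what the two factors [G] record ([card_matchings_run]).

    The Taylor coefficients of [exp (x^2 / 2)] are obtained without power
    series.  On the circle, the derivative in the angle of
    [exp (x^2 / 2) x^-n] integrates to zero over a full turn; this expresses
    the contour moment of order [n] by that of order [n - 2] ([contour_parts]).
    The two initial values are circle means of entire functions, which do not
    depend on the radius because the radial and the angular derivative are
    proportional ([polar_mean_const]). *)

(** * Formal power series and the Chebyshev polynomials *)

(** The Chebyshev polynomial [U_n] of the second kind, in the normalization that
    takes its usual value at [s / 2].  It is defined at an element [s] of a ring,
    so that the same recurrence serves polynomials, their values and power
    series. *)
Fixpoint chebU (S : pzRingType) (s : S) (n : nat) : S :=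
  if n is m.+1 then if m is k.+1 then s * chebU s m - chebU s k else s else 1.

Arguments chebU : simpl never.

(** The coefficients of [1 + y^2 / (1 - s y)]: a side of a bubble either is
    empty, or starts with a short chord and continues freely. *)
Definition flank (S : pzRingType) (s : S) (n : nat) : S :=
  if n is m.+1 then if m is k.+1 then s ^+ k else 0 else 1.

Lemma chebUSS (S : pzRingType) (s : S) n :
  chebU s n.+2 = s * chebU s n.+1 - chebU s n.
Proof. by []. Qed.

Lemma chebU_morph (S T : pzRingType) (f : S -> T) (s : S) n :
  f 1 = 1 -> {morph f : a b / a * b} -> {morph f : a b / a - b} ->
  chebU (f s) n = f (chebU s n).
Proof.
move=> f1 fM fB; suff [] : chebU (f s) n = f (chebU s n) /\
  chebU (f s) n.+1 = f (chebU s n.+1) by [].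
elim: n => [|n [IH1 IH2]]; first by [].
by split=> //; rewrite !chebUSS IH1 IH2 fB fM.
Qed.

(** The exponent is the number of vertices left once a side that is long enough
    has lost the two vertices of its short chord. *)
Lemma flankE (S : pzRingType) (s : S) n : n != 1%N ->
  flank s n = s ^+ (n - 2 * (1 < n)%N).
Proof. by case: n => [|[|n]] // _; rewrite /= muln1 subSS subSS subn0. Qed.

(** The index [b] is the position at which the bubble ends; it starts at
    [b - p]. *)
Definition bubble_coef (S : pzRingType) (s : S) (m p : nat) : S :=
  \sum_(b < m.+1 | (0 < p <= b)%N)
     flank s (b - p) * chebU s p * flank s (m - b).

Lemma FpsE (K : Type) (a : nat -> K) m : Fps a m = a m.
Proof. by []. Qed.

Lemma fpsXM_coef (K : comNzRingType) (f : fps K) m :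
  (fpsX K * f) m = if m is k.+1 then f k else 0.
Proof.
rewrite fpsM_coef big_ord_recl /= mul0r add0r.
case: m => [|m]; first by rewrite big_ord0.
rewrite big_ord_recl /= mul1r subSS subn0 big1 ?addr0// => i _.
by rewrite /= mul0r.
Qed.

Lemma fpsCB (K : comNzRingType) : {morph @fpsC K : a b / a - b}.
Proof. by move=> a b; apply/fpsP => -[|m]; rewrite /= ?oppr0 ?addr0. Qed.
Lemma fpsCM (K : comNzRingType) : {morph @fpsC K : a b / a * b}.
Proof.
by move=> a b; apply/fpsP => -[|m]; rewrite fpsCM_coef//= mulr0.
Qed.
Lemma fpsCN1 (K : comNzRingType) : fpsC (-1 : K) = -1.
Proof. by rewrite -[-1]sub0r fpsCB -[RHS]sub0r; congr (_ - _);
  apply/fpsP => -[]. Qed.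

Lemma chebU_fps (K : comNzRingType) (s w : K) :
  (1 - fpsC (s * w) * fpsX K + (fpsC w * fpsX K) ^+ 2) *
    Fps (fun n => chebU s n * w ^+ n) = 1.
Proof.
apply/fpsP => m; rewrite expr2 mulrDl mulrBl mul1r !fpsD_coef fpsN_coef.
rewrite -!mulrA !fpsCM_coef !fpsXM_coef fps1_coef.
case: m => [|[|m]]; rewrite ?fpsCM_coef ?fpsXM_coef !FpsE.
- by rewrite /chebU /= mulr1 !mulr0 subr0 addr0.
- by rewrite /chebU /= expr0 !mulr0 !mulr1 addr0 expr1 subrr.
- by rewrite !(exprS w) (chebUSS s) [RHS]/=; ring.
Qed.

Lemma flank_fps (K : comNzRingType) (s : K) :
  (1 - fpsC s * fpsX K) * Fps (flank s) = 1 - fpsC s * fpsX K + fpsX K ^+ 2.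
Proof.
apply/fpsP => m; rewrite expr2 mulrBl mul1r !fpsD_coef !fpsN_coef.
rewrite -!mulrA !fpsCM_coef !fpsXM_coef fps1_coef.
case: m => [|[|[|m]]]; rewrite !FpsE ?fpsXM_coef.
- by rewrite /= !mulr0 subr0 addr0.
- by rewrite /= add0r mulr1 addr0.
- by rewrite /= expr0 mulr0 !subr0 add0r.
- by rewrite -[flank s m.+3]/(s ^+ m.+1) exprS subrr /= mulr0 subr0 addr0.
Qed.

Lemma fps_inv_eq (K : comUnitRingType) (f g : fps K) : f * g = 1 -> f^-1 = g.
Proof.
move=> fg; have uf : f \is a GRing.unit by apply/unitrP; exists g; rewrite mulrC.
by rewrite -[LHS]mulr1 -fg mulKr.
Qed.

(** The arguments [s = t / x] and [u = i x / t] of the theorem satisfy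
    [u^2 s^2 = -1], which makes the quadratic term of the denominator [+ y^2]. *)
Lemma Lser_fps (K : comUnitRingType) (s w u : K) :
  u ^+ 2 * s ^+ 2 = -1 ->
  Lser (fpsC u) (fpsC (s * w) * fpsX K) = Fps (fun n => chebU s n * w ^+ n).
Proof.
move=> us; rewrite /Lser; apply: fps_inv_eq.
rewrite -[RHS](chebU_fps s w); congr (_ * _).
set Y := fpsX K; have -> : 1 - fpsC (s * w) * Y * (1 + fpsC u ^+ 2 *
   (fpsC (s * w) * Y)) = 1 - fpsC (s * w) * Y
    - (fpsC u ^+ 2 * fpsC s ^+ 2) * (fpsC w * Y) ^+ 2.
  by rewrite fpsCM; ring.
by rewrite !expr2 -!fpsCM -!expr2 us fpsCN1; ring.
Qed.

(** Since [1 - y^2 / (1 - s y + y^2) = (1 - s y) / (1 - s y + y^2)], the inverse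
    is [1 + y^2 / (1 - s y)]. *)
Lemma flank_inv_fps (K : comUnitRingType) (s : K) :
  (1 - fpsX K ^+ 2 * Fps (chebU s))^-1 = Fps (flank s).
Proof.
set Y := fpsX K; set U := Fps _; set G := Fps _.
have hU : (1 - fpsC s * Y + Y ^+ 2) * U = 1.
  have := chebU_fps s 1; rewrite mulr1 -[fpsC 1]/(1 : fps K) mul1r.
  by rewrite (_ : Fps _ = U)//; apply/fpsP => m /=; rewrite expr1n mulr1.
have hG : (1 - fpsC s * Y) * G = 1 - fpsC s * Y + Y ^+ 2 by exact: flank_fps.
have u : 1 - fpsC s * Y \is a GRing.unit.
  change (is_true ((1 - fpsC s * Y) 0%N \is a GRing.unit)).
  by rewrite fpsD_coef fpsN_coef fpsCM_coef fps1_coef /= mulr0 subr0 unitr1.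
apply: fps_inv_eq; apply: (mulrI u); rewrite mulrCA hG mulr1 mulrC mulrBr.
by rewrite mulr1 mulrCA hU mulr1 addrK.
Qed.

Lemma calL_fps_coef (K : comUnitRingType) (s u : K) m p :
  u ^+ 2 * s ^+ 2 = -1 ->
  calL (fpsC (fpsC s)) (fpsC (fpsX K)) (fpsC (fpsC u)) (fpsX (fps K)) m p =
  bubble_coef s m p.
Proof.
move=> us; have us' : fpsC u ^+ 2 * fpsC s ^+ 2 = -1.
  by rewrite !expr2 -!fpsCM -!expr2 us fpsCN1.
rewrite /calL; set Y := fpsX (fps K).
have L1 : Lser (fpsC (fpsC u)) (fpsC (fpsC s) * Y) = Fps (chebU (fpsC s)).
  have := @Lser_fps (fps K) (fpsC s) 1 (fpsC u) us'.
  by rewrite mulr1 => ->; apply/fpsP => n /=; rewrite expr1n mulr1.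
have L2 := @Lser_fps (fps K) (fpsC s) (fpsX K) (fpsC u) us'.
rewrite -/Y in L2; rewrite L1 -[_ * fpsC (fpsC s)]fpsCM [fpsX K * _]mulrC L2.
rewrite flank_inv_fps fpsM_coef -[LHS]/(fps_coef (\sum_(b < m.+1) _) p).
have fps_sum N (P : pred 'I_N) (F : 'I_N -> fps K) q :
    (\sum_(i < N | P i) F i) q = \sum_(i < N | P i) F i q.
  by elim/big_ind2 : _ => // f a g b <- <-.
rewrite fps_sum [RHS]big_mkcond; apply: eq_bigr => b _.
rewrite [X in X * _]fpsM_coef mulr_suml fps_sum.
have flankC n : flank (fpsC s) n = fpsC (flank s n).
  case: n => [|[|n]] //=; first by apply/fpsP => -[].
  by elim: n => [|n IH]; rewrite ?expr0// !exprS fpsCM IH.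
have chebC n : chebU (fpsC s) n = fpsC (chebU s n).
  by apply: chebU_morph; [|exact: fpsCM|exact: fpsCB].
have Xn n q : (fpsX K ^+ n) q = (q == n)%:R.
  elim: n q => [|n IH] q; first by rewrite expr0 fps1_coef.
  by rewrite exprS fpsXM_coef; case: q => [|q]//; rewrite IH.
have term (a : 'I_b.+1) : (Fps (flank (fpsC s)) a *
    (Fps (fun n => chebU (fpsC s) n * fpsX K ^+ n) - 1) (b - a)%N *
    Fps (flank (fpsC s)) (m - b)%N) p =
  if (0 < p)%N && (b - a == p)%N
  then flank s a * chebU s p * flank s (m - b) else 0.
  rewrite fpsD_coef fpsN_coef fps1_coef.
  rewrite [Fps (flank _) a]FpsE [Fps (flank _) _]FpsE [Fps _ (b - a)%N]FpsE.
  rewrite !flankC chebC.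
  rewrite mulrAC -fpsCM fpsCM_coef fpsD_coef fpsCM_coef Xn fpsN_coef.
  have -> : (((b - a)%N == 0%N)%:R : fps K) p = ((b - a == 0) && (p == 0))%N%:R.
    by case: eqP => _ /=; [exact: fps1_coef|].
  rewrite (eq_sym p); case: (b - a == p)%N / eqP => [->|ne] /=.
    rewrite andbT andbb; case: p => [|p] /=; first by rewrite mulr1 subrr mulr0.
    by rewrite mulr1 subr0 mulrAC.
  rewrite andbF mulr0 sub0r; case: eqP => [b0|_] /=; last by rewrite oppr0 mulr0.
  by case: eqP => [p0|]; [case: ne; rewrite b0 p0|rewrite oppr0 mulr0].
rewrite (eq_bigr _ (fun a _ => term a)) -big_mkcond/=.
case: ifP => [/andP[p0 pb]|npb]; last first.
  apply: big_pred0 => a; apply: contraFF npb => /andP[-> /eqP <-].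
  exact: leq_subr.
have ltb : (b - p < b.+1)%N by rewrite ltnS leq_subr.
rewrite (big_pred1 (Ordinal ltb))// => a; rewrite p0 /= -val_eqE /=.
by have := ltn_ord a; lia.
Qed.

(** * Matchings, moments and bubbles *)

Fixpoint matching_number (n : nat) : nat :=
  if n is m.+1 then if m is k.+1 then (m * matching_number k)%N else 0%N else 1%N.

(** The linear functional whose value at ['X^k] is the number of perfect
    matchings of [k] points; these numbers are the moments of the standard
    Gaussian distribution. *)
Definition moment (K : nzRingType) (q : {poly K}) : K :=
  \sum_(k < size q) q`_k * (matching_number k)%:R.

Lemma momentE (K : nzRingType) N (q : {poly K}) : (size q <= N)%N ->
  moment q = \sum_(k < N) q`_k * (matching_number k)%:R.
Proof.
move=> qN; rewrite /moment.
rewrite (big_ord_widen N (fun k => q`_k * (matching_number k)%:R))//.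
rewrite [LHS]big_mkcond; apply: eq_bigr => k _; case: ltnP => // kq.
by rewrite nth_default ?mul0r.
Qed.

Lemma momentB (K : nzRingType) : {morph @moment K : p q / p - q}.
Proof.
move=> p q; pose N := maxn (size p) (size q).
rewrite !(@momentE _ N) ?leq_maxl ?leq_maxr//; last first.
  by rewrite (leq_trans (size_polyD _ _))// size_polyN.
rewrite -sumrB; apply: eq_bigr => k _.
by rewrite coefB mulrBl.
Qed.

Lemma moment0 (K : nzRingType) : moment (0 : {poly K}) = 0.
Proof. by rewrite /moment size_poly0 big_ord0. Qed.

Lemma momentD (K : nzRingType) : {morph @moment K : p q / p + q}.
Proof.
by move=> p q; rewrite -[q in LHS]opprK -[- q]sub0r !momentB moment0 sub0r opprK.
Qed.

Lemma moment_sum (K : nzRingType) (I : finType) (P : pred I)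
    (F : I -> {poly K}) :
  moment (\sum_(i | P i) F i) = \sum_(i | P i) moment (F i).
Proof. by apply: big_morph; [exact: momentD|exact: moment0]. Qed.

Lemma momentXn (K : nzRingType) n :
  moment ('X^n : {poly K}) = (matching_number n)%:R.
Proof.
rewrite (@momentE _ n.+1) ?size_polyXn// big_ord_recr /= coefXn eqxx mul1r.
rewrite big1 ?add0r// => i _.
by rewrite coefXn ltn_eqF ?mul0r.
Qed.

Section Matchings.
Import mathcomp.boot.finset.
Variable T : finType.
Implicit Types (V c : {set T}) (D : {set {set T}}) (s : seq T).

Definition matchings V : {set {set {set T}}} :=
  [set D | partition D V & [forall c in D, #|c| == 2%N]].

(** Unlike a rewrite with [inE], this leaves membership in a defined set such as
    [matchings V] folded. *)
Lemma in_set_cond (M : {set {set {set T}}}) (P : pred {set {set T}}) D :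
  (D \in [set D in M | P D]) = (D \in M) && P D.
Proof. by rewrite inE. Qed.

Lemma matchingsP V D : reflect
  [/\ cover D = V, trivIset D & forall c, c \in D -> #|c| = 2%N]
  (D \in matchings V).
Proof.
rewrite inE /partition; apply: (iffP andP).
  by move=> [/and3P[/eqP ? ? _] /forall_inP D2]; split=> // c /D2 /eqP.
move=> [-> tD D2]; split; last by apply/forall_inP => c /D2 ->.
by rewrite eqxx tD; apply/negP => /D2; rewrite cards0.
Qed.

Lemma matching_meet V D c c' v : D \in matchings V -> c \in D -> c' \in D ->
  v \in c -> v \in c' -> c = c'.
Proof.
move=> /matchingsP[_ tD _] cD c'D vc vc'.
by rewrite -(def_pblock tD cD vc) -(def_pblock tD c'D vc').
Qed.

Lemma matchingD1 V D c : D \in matchings V -> c \in D ->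
  D :\ c \in matchings (V :\: c).
Proof.
move=> DM cD; have /matchingsP[DV tD D2] := DM; apply/matchingsP; split.
- apply/setP => v; rewrite -DV !inE; apply/bigcupP/andP.
    move=> [c']; rewrite !inE => /andP[c'c c'D] vc'; split; last first.
      by apply/bigcupP; exists c'.
    by apply: contra c'c => vc; rewrite (matching_meet DM c'D cD vc' vc).
  move=> [vc /bigcupP[c' c'D vc']]; exists c' => //; rewrite !inE c'D andbT.
  by apply: contraNneq vc => <-.
- by apply: trivIsetS tD; apply: subD1set.
- by move=> c'; rewrite inE => /andP[_ /D2].
Qed.

Lemma matchingU1 V D c : c \subset V -> #|c| = 2%N ->
  D \in matchings (V :\: c) -> c \notin D /\ c |: D \in matchings V.
Proof.
move=> cV c2 DM; have /matchingsP[DV tD D2] := DM.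
have disj c' : c' \in D -> [disjoint c & c'].
  move=> c'D; apply/pred0P => v /=; apply/negP => /andP[vc vc'].
  have : v \in cover D by apply/bigcupP; exists c'.
  by rewrite DV inE vc.
split.
  apply/negP => /disj; rewrite -setI_eq0 setIid => /eqP c0.
  by move: c2; rewrite c0 cards0.
apply/matchingsP; split.
- rewrite /cover bigcup_setU big_set1 -/(cover D) DV.
  by rewrite setUC -[X in _ :|: X](setIidPr cV) setUC setID.
- rewrite /trivIset; apply/trivIsetP => A B.
  rewrite !inE => /predU1P[->|AD] /predU1P[->|BD]; rewrite ?eqxx//.
  + by move=> _; apply: disj.
  + by rewrite disjoint_sym => _; apply: disj.
  + exact: (trivIsetP tD).
- by move=> c'; rewrite !inE => /predU1P[->//|/D2].
Qed.

(** Deleting a given chord is a bijection onto the matchings of the remaining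
    points, with adding the chord back as its inverse. *)
Lemma card_matchings_chord V c (P : pred {set {set T}}) :
  c \subset V -> #|c| = 2%N ->
  #|[set D in matchings V | (c \in D) && P (D :\ c)]| =
  #|[set D in matchings (V :\: c) | P D]|.
Proof.
move=> cV c2; rewrite -[RHS](card_in_imset (f := fun D => c |: D)); last first.
  move=> D D'; rewrite !in_set_cond => /andP[DM _] /andP[D'M _] /= e.
  have [cD _] := matchingU1 cV c2 DM; have [cD' _] := matchingU1 cV c2 D'M.
  by rewrite -(setU1K cD) e setU1K.
apply: eq_card => D; rewrite in_set_cond; apply/idP/imsetP.
  move=> /and3P[DM cD PD]; exists (D :\ c); last by rewrite setD1K.
  by rewrite in_set_cond matchingD1.
move=> [D']; rewrite in_set_cond => /andP[D'M PD'] ->.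
have [cD' ->] := matchingU1 cV c2 D'M.
by rewrite setU11 setU1K.
Qed.

(** Classify the matchings of [V] by the partner [w] of a fixed point [v]. *)
Lemma card_matchings V : #|matchings V| = matching_number #|V|.
Proof.
have [n] := ubnP #|V|; elim: n V => // n IH V; rewrite ltnS => Vn.
have [->|[v vV]] := set_0Vmem V.
  rewrite cards0 -[RHS](cards1 (set0 : {set {set T}})).
  apply: eq_card => D; rewrite in_set1; apply/matchingsP/eqP => [[D0 _ D2]|->].
    apply/setP => c; rewrite in_set0; apply/negP => cD.
    have /card_gt0P[v vc] : (0 < #|c|)%N by rewrite D2.
    have : v \in cover D by apply/bigcupP; exists c.
    by rewrite D0 inE.
  split; last by move=> c; rewrite inE.
    by rewrite /cover big_set0.
  by apply/trivIsetP => A B; rewrite inE.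
have -> : #|matchings V| =
    (\sum_(w in V :\ v) #|[set D in matchings V | [set v; w] \in D]|)%N.
  under eq_bigr do rewrite -sum1dep_card big_mkcondr.
  rewrite exchange_big /= -sum1_card; apply: eq_bigr => D DM.
  have /matchingsP[DV tD D2] := DM.
  have vD : v \in cover D by rewrite DV.
  have pD := pblock_mem vD; have vp : v \in pblock D v by rewrite mem_pblock.
  have /eqP := D2 _ pD; rewrite (cardsD1 v) vp eqSS => /cards1P[u pu].
  have pE : pblock D v = [set v; u] by rewrite -(setD1K vp) pu.
  have uv : u != v.
    have : u \in pblock D v :\ v by rewrite pu inE.
    by rewrite !inE => /andP[].
  have uV : u \in V :\ v.
    rewrite !inE uv -DV; apply/bigcupP; exists (pblock D v) => //.
    by rewrite pE !inE eqxx orbT.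
  rewrite (bigD1 u)//= -pE pD big1// => w /andP[wV wu]; case: ifP => // wD.
  have e : [set v; w] = [set v; u] by rewrite -pE (def_pblock tD wD (set21 v w)).
  have : w \in [set v; u] by rewrite -e set22.
  by move: wV; rewrite !inE => /andP[/negPf-> _]; rewrite (negPf wu).
have wE w : w \in V :\ v ->
    #|[set D in matchings V | [set v; w] \in D]| = matching_number (#|V| - 2).
  rewrite !inE => /andP[wv wV].
  have c2 : #|[set v; w]| = 2%N by rewrite cards2 eq_sym wv.
  have cV : [set v; w] \subset V by rewrite subUset !sub1set vV.
  have := card_matchings_chord predT cV c2.
  rewrite (eq_card (B := [set D in matchings V | [set v; w] \in D])); last first.
    by move=> D; rewrite !in_set_cond andbT.
  move=> ->; rewrite (eq_card (B := matchings (V :\: [set v; w]))); last first.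
    by move=> D; rewrite in_set_cond andbT.
  have cardE : #|V :\: [set v; w]| = (#|V| - 2)%N.
    by rewrite cardsD (setIidPr cV) c2.
  have V0 : (0 < #|V|)%N by apply/card_gt0P; exists v.
  by rewrite IH cardE//; lia.
rewrite (eq_bigr _ wE) sum_nat_const; have := cardsD1 v V; rewrite vV => ->.
by case: #|V :\ v| => [|k]//; rewrite add1n !subSS subn0.
Qed.

(** [s] is read as a path; its consecutive entries must not be matched. *)
Definition avoids s D := sorted (fun x y => [set x; y] \notin D) s.

Lemma avoidsD1 s D c v : v \in c -> v \notin s -> avoids s (D :\ c) = avoids s D.
Proof.
move=> vc vs; apply: (eq_in_sorted (P := mem s)); last by apply/allP.
move=> x y xs ys; rewrite !inE negb_and negbK; case: eqP => // e.
by move: vc; rewrite -e !inE => /orP[]/eqP vE; move: vs; rewrite vE ?xs ?ys.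
Qed.

(** Inclusion and exclusion on the first edge [{v, w}] of the path.  When
    [{v, w}] is a chord, the second edge of the path cannot be one since it shares
    [w], so that after deletion of the chord only the path without its first two
    points constrains the matching.  This is the Chebyshev recurrence. *)
Lemma card_matchings_avoids (K : comNzRingType) s V :
  uniq s -> {subset s <= V} ->
  #|[set D in matchings V | avoids s D]|%:R =
  moment ('X^(#|V| - size s) * chebU 'X (size s)) :> K.
Proof.
have [n] := ubnP (size s); elim: n s V => // n IH [|v [|w s]] V.
- move=> _ _ _; rewrite subn0 mulr1 momentXn -card_matchings; congr _%:R.
  by apply: eq_card => D; rewrite in_set_cond andbT.
- move=> _ _ /(_ v (mem_head _ _)) vV; rewrite /= -exprSr.
  have V0 : (0 < #|V|)%N by apply/card_gt0P; exists v.
  rewrite subn1 prednK// momentXn -card_matchings; congr _%:R.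
  by apply: eq_card => D; rewrite in_set_cond andbT.
move=> sn us sV.
have vV : v \in V by apply: sV; rewrite mem_head.
have wV : w \in V by apply: sV; rewrite !inE eqxx orbT.
have := us; rewrite /= inE negb_or => /andP[/andP[vw vs] /andP[ws us']].
have c2 : #|[set v; w]| = 2%N by rewrite cards2 vw.
have cV : [set v; w] \subset V by rewrite subUset !sub1set vV.
have cardE : #|V :\: [set v; w]| = (#|V| - 2)%N.
  by rewrite cardsD (setIidPr cV) c2.
have subV : {subset s <= V :\: [set v; w]}.
  move=> x xs; rewrite !inE negb_or sV ?inE ?xs ?orbT// andbT.
  by apply/andP; split; [apply: contraNneq vs => <-|apply: contraNneq ws => <-].
have sizeV : ((size s).+2 <= #|V|)%N.
  rewrite -[_.+2]/(size [:: v, w & s]) -(card_uniqP us).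
  by apply: subset_leq_card; apply/fintype.subsetP.
have split_card : #|[set D in matchings V | avoids (w :: s) D]| =
  (#|[set D in matchings V | avoids [:: v, w & s] D]| +
   #|[set D in matchings (V :\: [set v; w]) | avoids s D]|)%N.
  rewrite -(card_matchings_chord (avoids s) cV c2).
  rewrite -(cardsID [set D : {set {set T}} | [set v; w] \in D]) addnC; congr addn.
    apply: eq_card => D; rewrite in_setD !in_set_cond [D \in finset _]inE.
    by rewrite /avoids /=; case: (_ \in D); rewrite ?andbF ?andbT.
  apply: eq_card => D; rewrite in_setI !in_set_cond [D \in finset _]inE -!andbA.
  apply: andb_id2l => DM.
  rewrite andbC; apply: andb_id2l => cD; rewrite (avoidsD1 _ (set21 v w) vs).
  rewrite /avoids; case: s us sV vs ws {us' subV sn sizeV} => //= u s us sV vs ws.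
  have uD : [set w; u] \notin D.
    apply/negP => uD; have e := matching_meet DM cD uD (set22 _ _) (set21 _ _).
    have : v \in [set w; u] by rewrite -e set21.
    by move: vs; rewrite !inE (negPf vw) negb_or => /andP[/negPf->].
  by rewrite uD.
have -> : #|[set D in matchings V | avoids [:: v, w & s] D]|%:R =
  #|[set D in matchings V | avoids (w :: s) D]|%:R -
  #|[set D in matchings (V :\: [set v; w]) | avoids s D]|%:R :> K.
  by rewrite split_card natrD addrK.
have sn' : ((size s).+2 < n.+1)%N by [].
rewrite (IH (w :: s)); [|exact: sn'|by rewrite /= ws|]; last first.
  by move=> x xs; apply: sV; rewrite inE xs orbT.
rewrite IH//; last by rewrite -ltnS; apply: ltnW.
rewrite -momentB cardE -[size (w :: s)]/(size s).+1.
rewrite chebUSS; congr moment.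
have -> : (#|V| - (size s).+1 = (#|V| - (size s).+2).+1)%N by lia.
have -> : (#|V| - 2 - size s = (#|V| - (size s).+2))%N by lia.
by rewrite mulrBr mulrA exprSr.
Qed.

(** Each prescribed chord just removes two points that lie off the path. *)
Lemma card_matchings_forced_avoids (K : comNzRingType) (cs : seq {set T}) s V :
  uniq s -> {subset s <= V} ->
  all (fun c => [&& c \subset V, #|c| == 2%N & [disjoint c & s]]) cs ->
  pairwise (fun c c' : {set T} => [disjoint c & c']) cs ->
  #|[set D in matchings V | all [in D] cs && avoids s D]|%:R =
  moment ('X^(#|V| - 2 * size cs - size s) * chebU 'X (size s)) :> K.
Proof.
move=> us; elim: cs V => [|c cs IH] V sV /=.
  by move=> _ _; rewrite muln0 subn0 card_matchings_avoids.
move=> /andP[/and3P[cV /eqP c2 cs_disj] allc] /andP[c_disj cs_pair].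
have cardE : #|V :\: c| = (#|V| - 2)%N by rewrite cardsD (setIidPr cV) c2.
have := card_matchings_chord (fun D => all [in D] cs && avoids s D) cV c2.
rewrite (eq_card (B := [set D in matchings V | all [in D] (c :: cs) && avoids s D])).
  move=> ->; rewrite IH//.
  - by rewrite cardE; congr (moment ('X^_ * _)); lia.
  - move=> x xs; rewrite inE sV// andbT.
    by apply/negP => xc; move/pred0P: cs_disj => /(_ x) /=; rewrite xc xs.
  - apply/allP => c' c'cs; have /and3P[c'V -> ->] := allP allc _ c'cs.
    by rewrite !andbT subsetD c'V disjoint_sym (allP c_disj).
move=> D; rewrite !in_set_cond /=; apply: andb_id2l => DM; rewrite -andbA.
apply: andb_id2l => cD; have /card_gt0P[v vc] : (0 < #|c|)%N by rewrite c2.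
rewrite (avoidsD1 _ vc); last first.
  by apply/negP => vs; move/pred0P: cs_disj => /(_ v) /=; rewrite vc vs.
congr andb; apply: eq_in_all => c' c'cs; rewrite !inE.
case: eqP => // e; have := allP c_disj _ c'cs; rewrite e.
by move/pred0P => /(_ v) /=; rewrite vc.
Qed.

End Matchings.

Section Bubbles.
Import mathcomp.boot.finset.
Variable N : nat.
Implicit Types (D : {set {set 'I_N}}).

(** Defined by inequalities, so that no proof that [k] and [k + 1] are vertices
    is needed; it is a pair when [k + 1 < N]. *)
Definition edge (k : nat) : {set 'I_N} := [set i : 'I_N | (k <= i <= k.+1)%N].
Definition run (a b : nat) : {set 'I_N} := [set i : 'I_N | (a <= i < b)%N].

Lemma edgeE (i j : 'I_N) : j = i.+1 :> nat -> edge i = [set i; j].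
Proof.
move=> ji; apply/setP => k; rewrite !inE -!val_eqE /= ji.
by apply/idP/idP; lia.
Qed.

Lemma card_run a b : (b <= N)%N -> #|run a b| = (b - a)%N.
Proof.
move=> bN; rewrite cardsE cardE -(size_map val) -(size_iota a (b - a)).
apply: perm_size; apply: uniq_perm.
- by rewrite (map_inj_uniq val_inj) enum_uniq.
- exact: iota_uniq.
move=> k; rewrite mem_iota; apply/mapP/idP => [[j]|kab].
  by rewrite mem_enum => jab ->; move: jab; rewrite /in_mem /=; lia.
have kN : (k < N)%N by lia.
by exists (Ordinal kN) => //; rewrite mem_enum /= /in_mem /=; lia.
Qed.

Lemma card_edge k : (k.+1 < N)%N -> #|edge k| = 2%N.
Proof.
move=> kN; rewrite -[RHS](_ : k.+2 - k = 2)%N ?card_run//; last by lia.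
by rewrite -card_run//; apply: eq_card => i; rewrite !inE ltnS.
Qed.

Lemma on_short_chordP D (v : 'I_N) :
  reflect (exists k, [/\ (k.+1 < N)%N, edge k \in D & (k <= v <= k.+1)%N])
          (on_short_chord D v).
Proof.
apply: (iffP existsP).
  move=> [c /and3P[cD /existsP[i /existsP[j /andP[/eqP ji /eqP cE]]] vc]].
  have kE : edge i = c by rewrite cE; apply: edgeE.
  exists i; split; rewrite ?kE//.
    by have : (val j < N)%N := ltn_ord j; rewrite ji.
  by move: vc; rewrite -kE inE.
move=> [k [kN kD vk]]; exists (edge k); rewrite kD /= inE vk andbT.
apply/existsP; exists (Ordinal (ltnW kN)); apply/existsP; exists (Ordinal kN).
by rewrite eqxx /=; apply/eqP; rewrite -edgeE.
Qed.

Lemma edge_disjoint D j k (v : 'I_N) : D \in matchings [set: 'I_N] ->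
  edge j \in D -> edge k \in D -> (j.+1 < N)%N -> (k.+1 < N)%N ->
  (j <= v <= j.+1)%N -> (k <= v <= k.+1)%N -> j = k.
Proof.
move=> DM jD kD jN kN vj vk.
have vj' : v \in edge j by rewrite inE.
have vk' : v \in edge k by rewrite inE.
have /setP e := matching_meet DM jD kD vj' vk'.
have := e (Ordinal jN); have := e (Ordinal (ltnW jN)).
by rewrite !inE /=; lia.
Qed.

(** A nonempty consecutive set is the run from its minimum to its maximum. *)
Lemma bubble_runP D A : A \in bubbles D ->
  exists2 b : 'I_N.+1, (0 < #|A| <= b)%N & A = run (b - #|A|) b.
Proof.
rewrite inE => /andP[/set0Pn[v vA] /maxsetp /andP[consA _]].
have [M MA maxM] := arg_maxnP (fun i : 'I_N => val i) vA.
have [m mA minm] := arg_minnP (fun i : 'I_N => val i) vA.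
have AE : A = run m M.+1.
  apply/setP => k; rewrite !inE ltnS; apply/idP/idP => [kA|mkM].
    by apply/andP; split; [exact: minm|exact: maxM].
  by have /forall_inP/(_ m mA)/forall_inP/(_ M MA)/forallP/(_ k) := consA;
    rewrite mkM.
have mM : (m <= M)%N by exact: minm.
have cardA : #|A| = (M.+1 - m)%N by rewrite AE card_run.
exists (Ordinal (ltn_ord M : (M.+1 < N.+1)%N)); rewrite cardA /=; first lia.
by rewrite subKn//; lia.
Qed.

(** A neighbour [a - 1] of the run lies on a short chord by maximality, and this
    chord is [{a - 2, a - 1}] since [{a - 1, a}] would meet the run.  Conversely,
    the two flanking chords keep the end points of the run off short chords that
    leave the run, and stop every consecutive set that contains the run from
    growing. *)
Lemma bubbles_runE D a b : D \in matchings [set: 'I_N] -> (a < b <= N)%N ->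
  run a b \in bubbles D =
  [&& [forall k : 'I_N, (a <= k)%N && (k.+1 < b)%N ==> (edge k \notin D)],
      (a == 0) || (1 < a) && (edge (a - 2) \in D) &
      (b == N) || (b.+1 < N) && (edge b \in D)]%N.
Proof.
move=> DM /andP[ab bN]; have aN : (a < N)%N by lia.
apply/idP/idP.
  rewrite inE => /andP[_ /maxsetP[/andP[_ /forall_inP noS] maxr]].
  have off (v : 'I_N) k : (a <= v < b)%N -> (k.+1 < N)%N -> (k <= v <= k.+1)%N ->
      edge k \notin D.
    move=> vab kN kv; apply/negP => kD.
    by have := noS v; rewrite inE => /(_ vab)/negP; apply; apply/on_short_chordP;
      exists k.
  have grow a' b' : (a' <= a)%N -> (b <= b')%N ->
      (forall v : 'I_N, (a' <= v < b')%N -> ~~ (a <= v < b)%N ->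
         ~~ on_short_chord D v) -> run a' b' = run a b.
    move=> a'a bb' noS'; apply: maxr; last first.
      by apply/fintype.subsetP => v; rewrite !inE; lia.
    apply/andP; split; last first.
      apply/forall_inP => v; rewrite inE => va'b'.
      case: (boolP (a <= v < b)%N) => [vab|]; last exact: noS'.
      by apply: noS; rewrite inE.
    apply/forall_inP => i; rewrite inE => ia; apply/forall_inP => j; rewrite inE => ja.
    by apply/forallP => k; apply/implyP; rewrite inE; lia.
  apply/and3P; split.
  - apply/forallP => k; apply/implyP => /andP[ak kb].
    by apply: (off k); lia.
  - case: (posnP a) => //= a0.
    have aN' : (a.-1 < N)%N by lia.
    have : on_short_chord D (Ordinal aN').
      apply: contraT => noa.
      have /setP/(_ (Ordinal aN')) : run a.-1 b = run a b.
        apply: grow => [||v v1 v2]; [lia|lia|].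
        by rewrite (_ : v = Ordinal aN')//; apply: val_inj => /=; lia.
      by rewrite !inE /=; lia.
    move=> /on_short_chordP[k [kN kD /= kv]].
    have [kE|kE] : k = (a - 2)%N /\ (1 < a)%N \/ k = a.-1 by lia.
      by rewrite -kE.1 kE.2 kD.
    have := off (Ordinal aN) k; rewrite kD /=; lia.
  - case: (eqVneq b N) => //= bN'.
    have bN2 : (b < N)%N by lia.
    have : on_short_chord D (Ordinal bN2).
      apply: contraT => nob.
      have /setP/(_ (Ordinal bN2)) : run a b.+1 = run a b.
        apply: grow => [||v v1 v2]; [lia|lia|].
        by rewrite (_ : v = Ordinal bN2)//; apply: val_inj => /=; lia.
      by rewrite !inE /=; lia.
    move=> /on_short_chordP[k [kN kD /= kv]].
    have [kE|kE] : k = b \/ k = b.-1 by lia.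
      by rewrite -kE kD andbT.
    have bN3 : (b.-1 < N)%N by lia.
    have := off (Ordinal bN3) k; rewrite kD /=; lia.
move=> /and3P[/forallP path La Rb].
have noS (v : 'I_N) : (a <= v < b)%N -> ~~ on_short_chord D v.
  move=> vab; apply/negP => /on_short_chordP[k [kN kD kv]].
  have [k1|[k2|k3]] : ((a <= k /\ k.+1 < b) \/ (k.+1 = a) \/ (k.+1 = b))%N by lia.
  - have /implyP := path (Ordinal (ltnW kN)); rewrite kD /=; lia.
  - move: La => /orP[/eqP|/andP[a1 aD]]; first lia.
    have := @edge_disjoint D k (a - 2) (Ordinal (ltnW kN)) DM kD aD; rewrite /=; lia.
  - move: Rb => /orP[/eqP|/andP[b1 bD]]; first lia.
    have := @edge_disjoint D k b (Ordinal kN) DM kD bD; rewrite /=; lia.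
rewrite inE; apply/andP; split.
  by apply/set0Pn; exists (Ordinal aN); rewrite inE /=; lia.
apply/maxsetP; split.
  apply/andP; split; last by apply/forall_inP => v; rewrite inE; exact: noS.
  apply/forall_inP => i; rewrite inE => ia; apply/forall_inP => j; rewrite inE => ja.
  by apply/forallP => k; apply/implyP; rewrite inE; lia.
move=> B /andP[/forall_inP consB /forall_inP noSB] /fintype.subsetP AB.
have consB' (i j k : 'I_N) : i \in B -> j \in B -> (i <= k <= j)%N -> k \in B.
  by move=> iB jB ikj; have /forall_inP/(_ j jB)/forallP/(_ k) := consB i iB;
    rewrite ikj.
apply/eqP; rewrite eqEsubset; apply/andP; split; last by apply/fintype.subsetP.
apply/fintype.subsetP => x xB; rewrite inE; apply: contraT => nx.
have bN1 : (b.-1 < N)%N by lia.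
have aB : Ordinal aN \in B by apply: AB; rewrite inE /=; lia.
have bB : Ordinal bN1 \in B by apply: AB; rewrite inE /=; lia.
have [xa|bx] : (x < a)%N \/ (b <= x)%N by lia.
  have aN' : (a.-1 < N)%N by lia.
  have : Ordinal aN' \in B by apply: (consB' x (Ordinal aN)) => //=; lia.
  move=> /noSB/negP; case; apply/on_short_chordP; exists (a - 2)%N.
  move: La => /orP[/eqP|/andP[a1 ->]]; first lia.
  by split=> //=; lia.
have bN' : (b < N)%N by have := ltn_ord x; lia.
have : Ordinal bN' \in B by apply: (consB' (Ordinal bN1) x) => //=; lia.
move=> /noSB/negP; case; apply/on_short_chordP; exists b.
move: Rb => /orP[/eqP|/andP[b1 ->]]; first lia.
by split=> //=; lia.
Qed.

(** If a side has exactly one vertex, there is no room for the flanking chord,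
    and accordingly the factor [flank 'X 1] vanishes. *)
Lemma card_matchings_run (K : comNzRingType) a b : (a < b <= N)%N ->
  #|[set D in matchings [set: 'I_N] | run a b \in bubbles D]|%:R =
  moment (flank 'X a * chebU 'X (b - a) * flank 'X (N - b)) :> K.
Proof.
move=> abN; have /andP[ab bN] := abN.
have empty_run : (a == 1)%N || (N - b == 1)%N ->
    #|[set D in matchings [set: 'I_N] | run a b \in bubbles D]| = 0%N.
  move=> ab1; apply/eqP; rewrite cards_eq0; apply/eqP/setP => D.
  rewrite in_set_cond in_set0; apply/negP => /andP[DM].
  by rewrite bubbles_runE// => /and3P[_]; lia.
have [a1|a1] := eqVneq a 1%N; first by rewrite empty_run a1//= !mul0r moment0.
have [b1|b1] := eqVneq (N - b)%N 1%N.
  by rewrite empty_run b1 ?orbT//= !mulr0 moment0.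
have aN : (a < N)%N by lia.
pose x0 := Ordinal aN; pose s := [seq insubd x0 k | k <- iota a (b - a)].
have vs : map val s = iota a (b - a).
  rewrite -map_comp -[RHS]map_id; apply/eq_in_map => k; rewrite mem_iota => kab /=.
  by rewrite val_insubd; case: ifP => //; lia.
have us : uniq s by apply: (map_uniq (f := val)); rewrite vs iota_uniq.
have ss : size s = (b - a)%N by rewrite size_map size_iota.
have sin x : x \in s -> (a <= x < b)%N.
  by move=> /(map_f val); rewrite vs mem_iota /=; lia.
have nths k : (k < b - a)%N -> nth x0 s k = (a + k)%N :> nat.
  move=> kab; rewrite (nth_map 0%N) ?size_iota// nth_iota//.
  by rewrite -[LHS]/(val _) val_insubd; case: ifP => //; lia.
have avoidsE D : avoids s D =
    [forall k : 'I_N, (a <= k)%N && (k.+1 < b)%N ==> (edge k \notin D)].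
  apply/(sortedP x0)/forallP => [sD k|sD k].
    apply/implyP => /andP[ak kb]; have := sD (k - a)%N; rewrite ss.
    move=> /(_ ltac:(lia)); rewrite -edgeE ?nths; try lia.
    by rewrite subnKC.
  rewrite ss => kab; rewrite -edgeE ?nths; try lia.
  have akN : (a + k < N)%N by lia.
  by have /implyP := sD (Ordinal akN); apply => /=; lia.
(* the flanking chords, one on each side that is not empty *)
pose cs := (if 1 < a then [:: edge (a - 2)] else [::])%N ++
           (if b.+1 < N then [:: edge b] else [::])%N.
have edge_s k : (k.+1 < a)%N || (b <= k)%N -> [disjoint edge k & s].
  move=> kab; apply/pred0P => x /=; apply/negP => /andP[xk /sin].
  by move: xk; rewrite inE; lia.
rewrite (eq_card (B := [set D in matchings [set: 'I_N] |
    all [in D] cs && avoids s D])); last first.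
  move=> D; rewrite !in_set_cond; apply: andb_id2l => DM.
  rewrite bubbles_runE// avoidsE andbC; congr andb; rewrite all_cat; congr andb.
    case: ltnP => a2 /=; first by rewrite andbT (gtn_eqF (ltnW a2)).
    by rewrite orbF; apply/eqP; lia.
  case: ltnP => b2 /=; first by rewrite andbT (ltn_eqF (ltnW b2)).
  by rewrite orbF; apply/eqP; lia.
rewrite card_matchings_forced_avoids//; last 3 first.
- by move=> x; rewrite inE.
- rewrite /cs; apply/allP => c; rewrite mem_cat => /orP[].
    case: ltnP => // a2; rewrite inE => /eqP ->.
    by rewrite subsetT card_edge ?edge_s//; lia.
  case: ltnP => // b2; rewrite inE => /eqP ->.
  by rewrite subsetT card_edge ?edge_s//; lia.
- rewrite /cs; do 2?[case: ltnP => //= ?]; rewrite ?andbT//.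
  by apply/pred0P => x /=; rewrite !inE; lia.
rewrite cardsT card_ord ss mulrAC !flankE// -exprD; congr (moment ('X^_ * _)).
rewrite /cs size_cat.
by case: (ltnP 1 a) => a2; case: (ltnP b.+1 N) => b2;
  case: (ltnP 1 (N - b)) => b3 /=; lia.
Qed.

(** A bubble of size [p] is determined by the position [b] at which it ends. *)
Lemma card_bubbles_size D p : (0 < p)%N ->
  #|[set A in bubbles D | #|A| == p]| =
  (\sum_(b < N.+1 | (0 < p <= b)%N) (run (b - p) b \in bubbles D))%N.
Proof.
move=> p0; rewrite -big_mkcondr /= sum1_card.
rewrite -(card_in_imset (f := fun b : 'I_N.+1 => run (b - p) b)).
  apply: eq_card => A; rewrite inE; apply/andP/imsetP.
    move=> [AB /eqP Ap]; have [b] := bubble_runP AB; rewrite Ap => pb AE.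
    by exists b => //; rewrite unfold_in pb -AE.
  move=> [b]; rewrite unfold_in => /andP[/andP[_ pb] bB] ->; split=> //.
  by rewrite card_run ?subKn// -ltnS.
move=> b b'; rewrite !unfold_in => /andP[/andP[_ pb] _] /andP[/andP[_ pb'] _] e.
apply: val_inj => /=; have bN := ltn_ord b; have bN' := ltn_ord b'.
have blt : (b.-1 < N)%N by lia.
have blt' : (b'.-1 < N)%N by lia.
have /setP E := e; have := E (Ordinal blt); have := E (Ordinal blt').
by rewrite !inE /=; lia.
Qed.

Lemma sum_bubbles_size (K : comNzRingType) p :
  (\sum_(D in matchings [set: 'I_N]) #|[set A in bubbles D | #|A| == p]|)%:R =
  moment (bubble_coef 'X N p) :> K.
Proof.
have [->|p0] := posnP p.
  rewrite /bubble_coef [X in moment X]big_pred0 ?moment0; last by move=> b.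
  rewrite big1// => D _; apply/eqP; rewrite cards_eq0; apply/eqP/setP => A.
  rewrite in_set0 !inE cards_eq0; apply/negP => /andP[/andP[/negP A0 _] A0'].
  exact: A0.
rewrite (eq_bigr _ (fun D _ => card_bubbles_size D p0)) exchange_big /=.
rewrite /bubble_coef moment_sum natr_sum; apply: eq_bigr => b /andP[_ pb].
have bN := ltn_ord b.
have := @card_matchings_run K (b - p) b; rewrite subKn// => <-; last by lia.
congr _%:R; rewrite -big_mkcondr /= sum1_card; apply: eq_card => D.
by rewrite in_set_cond.
Qed.

End Bubbles.

(** * Calculus for complex-valued functions of a real variable *)

Section ComplexCalculus.
Import numFieldNormedType.Exports.
Variable R : realType.
Implicit Types (f g : R -> R[i]) (z w : R[i]).
Local Notation Re := complex.Re.
Local Notation Im := complex.Im.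
Local Notation mu := (@lebesgue_measure R).
Local Open Scope classical_set_scope.

Lemma complex_ReD z w : Re (z + w) = Re z + Re w.
Proof. by case: z w => [a b] [c d]. Qed.
Lemma complex_ImD z w : Im (z + w) = Im z + Im w.
Proof. by case: z w => [a b] [c d]. Qed.
Lemma complex_ReM z w : Re (z * w) = Re z * Re w - Im z * Im w.
Proof. by case: z w => [a b] [c d]. Qed.
Lemma complex_ImM z w : Im (z * w) = Re z * Im w + Im z * Re w.
Proof. by case: z w => [a b] [c d]. Qed.
Lemma complex_ext z w : Re z = Re w -> Im z = Im w -> z = w.
Proof. by case: z w => [a b] [c d] /= -> ->. Qed.

Lemma expC0 : expC (0 : R[i]) = 1.
Proof. by rewrite /expC /= expR0 cos0 sin0 mulr1 mulr0. Qed.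

(** Complex derivatives of a function of a real variable, on the whole line.
    The derivative [f'] is a parameter, and a function is known to be
    continuous when some [f'] is exhibited; all functions below are smooth, so
    that this is the only regularity notion needed. *)
Definition Cderive f f' : Prop := forall t : R,
  is_derive t 1 (fun u => Re (f u)) (Re (f' t)) /\
  is_derive t 1 (fun u => Im (f u)) (Im (f' t)).

Lemma eq_Cderive f f' g' : Cderive f f' -> f' =1 g' -> Cderive f g'.
Proof. by move=> ff' /funext <-. Qed.

Lemma Cderive_cst z : Cderive (fun=> z) (fun=> 0).
Proof. by move=> t; split; exact: is_derive_cst. Qed.

Lemma Cderive_id : Cderive (fun t => t%:C%C) (fun=> 1).
Proof. by move=> t; split => /=; [exact: is_derive_id|exact: is_derive_cst]. Qed.

Lemma CderiveM f g f' g' : Cderive f f' -> Cderive g g' ->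
  Cderive (fun t => f t * g t) (fun t => f' t * g t + f t * g' t).
Proof.
move=> ff' gg' t; have [fr fi] := ff' t; have [gr gi] := gg' t; split.
  rewrite (_ : (fun _ => _) = (fun u => Re (f u)) * (fun u => Re (g u)) -
     (fun u => Im (f u)) * (fun u => Im (g u))); last first.
    by apply/funext => u; rewrite complex_ReM.
  apply: (is_derive_eq (is_deriveB (is_deriveM fr gr) (is_deriveM fi gi))).
  by rewrite !complex_ReD !complex_ReM /GRing.scale /=; ring.
rewrite (_ : (fun _ => _) = (fun u => Re (f u)) * (fun u => Im (g u)) +
     (fun u => Im (f u)) * (fun u => Re (g u))); last first.
  by apply/funext => u; rewrite complex_ImM.
apply: (is_derive_eq (is_deriveD (is_deriveM fr gi) (is_deriveM fi gr))).
by rewrite !complex_ImD !complex_ImM /GRing.scale /=; ring.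
Qed.

Lemma CderiveD f g f' g' : Cderive f f' -> Cderive g g' ->
  Cderive (fun t => f t + g t) (fun t => f' t + g' t).
Proof.
move=> ff' gg' t; have [fr fi] := ff' t; have [gr gi] := gg' t; split.
  rewrite (_ : (fun _ => _) = (fun u => Re (f u)) + (fun u => Re (g u))); last first.
    by apply/funext => u; rewrite complex_ReD.
  by rewrite complex_ReD; exact: is_deriveD.
rewrite (_ : (fun _ => _) = (fun u => Im (f u)) + (fun u => Im (g u))); last first.
  by apply/funext => u; rewrite complex_ImD.
by rewrite complex_ImD; exact: is_deriveD.
Qed.

Lemma Cderive_exp f f' : Cderive f f' ->
  Cderive (fun t => expC (f t)) (fun t => f' t * expC (f t)).
Proof.
move=> ff' t; have [fr fi] := ff' t.
have er : is_derive t 1 (expR \o (fun u => Re (f u))) (Re (f' t) * expR (Re (f t))).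
  by apply: is_derive_eq; rewrite /GRing.scale /= mulrC.
have ec : is_derive t 1 (cos \o (fun u => Im (f u))) (- (Im (f' t) * sin (Im (f t)))).
  by apply: is_derive_eq; rewrite /GRing.scale /=; ring.
have es : is_derive t 1 (sin \o (fun u => Im (f u))) (Im (f' t) * cos (Im (f t))).
  by apply: is_derive_eq; rewrite /GRing.scale /=; ring.
split; rewrite /expC /=.
  rewrite (_ : (fun _ => _) =
    (expR \o (fun u => Re (f u))) * (cos \o (fun u => Im (f u))))//.
  by apply: is_derive_eq; rewrite complex_ReM /GRing.scale /=; ring.
rewrite (_ : (fun _ => _) =
  (expR \o (fun u => Re (f u))) * (sin \o (fun u => Im (f u))))//.
by apply: is_derive_eq; rewrite complex_ImM /GRing.scale /=; ring.
Qed.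

(** Stated for logarithmic derivatives, because powers of [circle e] and of its
    inverse satisfy [f' = c f]. *)
Lemma CderiveX f (c : R -> R[i]) n : Cderive f (fun t => c t * f t) ->
  Cderive (fun t => f t ^+ n) (fun t => n%:R * c t * f t ^+ n).
Proof.
move=> fc; elim: n => [|n IH].
  by apply: (eq_Cderive (Cderive_cst 1)) => t; rewrite !mul0r.
rewrite (_ : (fun _ => _) = (fun t => f t * f t ^+ n)); last first.
  by apply/funext => t; rewrite exprS.
apply: (eq_Cderive (CderiveM fc IH)) => t.
by rewrite exprS -natr1; ring.
Qed.

Local Notation measurableR D := (measurable (D : set (measurableTypeR R))).

Lemma eq_Cintegrable D f g : measurableR D -> (forall t, D t -> f t = g t) ->
  Cintegrable D f -> Cintegrable D g.
Proof.
move=> mD fg [fr fi]; split.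
  by apply: (eq_integrable mD _ _ _ fr) => t /set_mem Dt; rewrite fg.
by apply: (eq_integrable mD _ _ _ fi) => t /set_mem Dt; rewrite fg.
Qed.

Lemma eq_Cintegral D f g : (forall t, D t -> f t = g t) ->
  Cintegral D f = Cintegral D g.
Proof.
by move=> fg; congr (_ +i* _)%C; apply: eq_Rintegral => t /set_mem Dt; rewrite fg.
Qed.

Lemma CintegrableD D f g : measurableR D -> Cintegrable D f -> Cintegrable D g ->
  Cintegrable D (fun t => f t + g t).
Proof.
move=> mD [fr fi] [gr gi]; split.
  under eq_fun do rewrite complex_ReD EFinD; exact: integrableD.
under eq_fun do rewrite complex_ImD EFinD; exact: integrableD.
Qed.

Lemma CintegralD D f g : measurableR D -> Cintegrable D f -> Cintegrable D g ->
  Cintegral D (fun t => f t + g t) = Cintegral D f + Cintegral D g.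
Proof.
move=> mD [fr fi] [gr gi]; apply: complex_ext; rewrite ?complex_ReD ?complex_ImD /=.
  by under eq_Rintegral do rewrite complex_ReD; rewrite RintegralD.
by under eq_Rintegral do rewrite complex_ImD; rewrite RintegralD.
Qed.

Let integrableZE D (r : R) (h : R -> R) : measurableR D ->
  mu.-integrable D (fun t => (h t)%:E) -> mu.-integrable D (fun t => (r * h t)%:E).
Proof. by move=> mD hi; under eq_fun do rewrite EFinM; exact: integrableZl. Qed.

Lemma CintegrableZ D f z : measurableR D -> Cintegrable D f ->
  Cintegrable D (fun t => z * f t).
Proof.
move=> mD [fr fi]; split.
  under eq_fun do rewrite complex_ReM EFinB.
  by apply: integrableB => //; exact: integrableZE.
under eq_fun do rewrite complex_ImM EFinD.
by apply: integrableD => //; exact: integrableZE.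
Qed.

Lemma CintegralZ D f z : measurableR D -> Cintegrable D f ->
  Cintegral D (fun t => z * f t) = z * Cintegral D f.
Proof.
move=> mD [fr fi]; apply: complex_ext; rewrite ?complex_ReM ?complex_ImM /=.
  under eq_Rintegral do rewrite complex_ReM.
  by rewrite RintegralB ?RintegralZl//; exact: integrableZE.
under eq_Rintegral do rewrite complex_ImM.
by rewrite RintegralD ?RintegralZl//; exact: integrableZE.
Qed.

Lemma Cintegrable0 D : measurableR D -> Cintegrable D (fun=> 0).
Proof. by move=> mD; split; exact: integrable0. Qed.

Lemma Cintegral0 D : Cintegral D (fun=> 0) = 0 :> R[i].
Proof. by rewrite /Cintegral /= /Rintegral integral0. Qed.

Lemma Cintegrable_sum D n (f : nat -> R -> R[i]) : measurableR D ->
  (forall k, Cintegrable D (f k)) -> Cintegrable D (fun t => \sum_(k < n) f k t).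
Proof.
move=> mD fi; elim: n => [|n IH].
  by under eq_fun do rewrite big_ord0; exact: Cintegrable0.
by under eq_fun do rewrite big_ord_recr; exact: CintegrableD.
Qed.

Lemma Cintegral_sum D n (f : nat -> R -> R[i]) : measurableR D ->
  (forall k, Cintegrable D (f k)) ->
  Cintegral D (fun t => \sum_(k < n) f k t) = \sum_(k < n) Cintegral D (f k).
Proof.
move=> mD fi; elim: n => [|n IH].
  by under eq_fun do rewrite big_ord0; rewrite big_ord0 Cintegral0.
under eq_fun do rewrite big_ord_recr; rewrite big_ord_recr -IH CintegralD//.
exact: Cintegrable_sum.
Qed.

Lemma Cderive_continuous f f' : Cderive f f' ->
  continuous (fun t => Re (f t)) /\ continuous (fun t => Im (f t)).
Proof.
move=> ff'; split=> t; have [fr fi] := ff' t.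
  exact/differentiable_continuous/derivable1_diffP.
exact/differentiable_continuous/derivable1_diffP.
Qed.

Lemma continuous_itv_integrable (h : R -> R) a b : continuous h ->
  mu.-integrable `[a, b] (fun t => (h t)%:E).
Proof.
move=> ch; apply: continuous_compact_integrable; first exact: segment_compact.
exact: continuous_subspaceT.
Qed.

Lemma Cderive_integrable f f' a b : Cderive f f' -> Cintegrable `[a, b] f.
Proof.
by move=> /Cderive_continuous[fr fi]; split; exact: continuous_itv_integrable.
Qed.

Lemma Rintegral_derive (F h : R -> R) a b : a < b -> continuous h ->
  (forall t : R, is_derive t 1 F (h t)) ->
  \int[mu]_(t in `[a, b]) h t = F b - F a.
Proof.
move=> ab ch Fh; have cF : continuous F.
  by move=> t; have Ft := Fh t; exact/differentiable_continuous/derivable1_diffP.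
rewrite /Rintegral (@continuous_FTC2 _ h F)//.
- exact: continuous_subspaceT.
- split.
  + by move=> t _; have Ft := Fh t.
  + exact/cvg_at_right_filter/cF.
  + exact/cvg_at_left_filter/cF.
- by move=> t _; have Ft := Fh t; rewrite derive1E derive_val.
Qed.

(** The third function [f''] only serves to make [f'] continuous. *)
Lemma Cintegral_derive f f' f'' a b : a < b -> Cderive f f' -> Cderive f' f'' ->
  Cintegral `[a, b] f' = f b - f a.
Proof.
move=> ab ff' /Cderive_continuous[cr ci]; apply: complex_ext => /=.
  rewrite (Rintegral_derive ab cr (fun t => (ff' t).1)).
  by case: (f a) (f b) => [x y] [x' y'].
rewrite (Rintegral_derive ab ci (fun t => (ff' t).2)).
by case: (f a) (f b) => [x y] [x' y'].
Qed.

(** A bound on both coordinates is stable under sums and products up to explicit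
    constants, which is all that dominated convergence asks for. *)
Definition Cbounded (M : R) z := `|Re z| <= M /\ `|Im z| <= M.

Lemma CboundedM M M' z w : Cbounded M z -> Cbounded M' w ->
  Cbounded (M * M' + M * M') (z * w).
Proof.
move=> [zr zi] [wr wi]; split; rewrite ?complex_ReM ?complex_ImM.
  by apply: (le_trans (ler_normB _ _)); rewrite !normrM lerD ?ler_pM.
by apply: (le_trans (ler_normD _ _)); rewrite !normrM lerD ?ler_pM.
Qed.

Lemma CboundedD M M' z w : Cbounded M z -> Cbounded M' w ->
  Cbounded (M + M') (z + w).
Proof.
move=> [zr zi] [wr wi]; split; rewrite ?complex_ReD ?complex_ImD.
  by apply: (le_trans (ler_normD _ _)); rewrite lerD.
by apply: (le_trans (ler_normD _ _)); rewrite lerD.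
Qed.

Lemma Cbounded_self z : Cbounded (`|Re z| + `|Im z|) z.
Proof. by split; rewrite ?lerDl ?lerDr. Qed.

Lemma Cbounded_exp M z : Cbounded M z -> Cbounded (expR M) (expC z).
Proof.
move=> [zr _]; have eM : `|expR (Re z)| <= expR M.
  by rewrite ger0_norm ?expR_ge0// ler_expR (le_trans (ler_norm _)).
have cs x : `|cos x| <= 1 /\ `|sin x| <= 1 :> R.
  by rewrite !ler_norml cos_geN1 cos_le1 sin_geN1 sin_le1.
by split; rewrite normrM -[leRHS]mulr1 ler_pM//; have [] := cs (Im z).
Qed.

(** Differentiation under the integral sign, followed by the mean value theorem
    on [[0, e]].  The hypothesis is about positive [r] only, since the
    proportionality used in [polar_mean_const] degenerates at [r = 0]. *)
Lemma integral_const_of_derive0 (h dh : R -> R -> R) (a b e : R) : 0 < e ->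
  (forall t r : R, is_derive r 1 (h ^~ t) (dh r t)) ->
  (forall r, continuous (h r)) ->
  (forall r, 0 < r -> \int[mu]_(t in `[a, b]) dh r t = 0) ->
  (forall B : R, exists M : R, forall r t : R, `|r| <= B -> `|dh r t| <= M) ->
  \int[mu]_(t in `[a, b]) h e t = \int[mu]_(t in `[a, b]) h 0 t.
Proof.
move=> e0 hd ch dh0 bd; pose F r := \int[mu]_(t in `[a, b]) h r t.
have dF (r : R) : is_derive r 1 F (\int[mu]_(t in `[a, b]) dh r t).
  have [M HM] := bd (`|r| + 1).
  have p1 x y : partial1of2 h x y = dh x y.
    by rewrite partial1of2E; have := hd y x => ?; rewrite derive_val.
  have Ir : `]r - 1, r + 1[ r by rewrite /= in_itv /=; lra.
  have hint x : `]r - 1, r + 1[ x -> mu.-integrable `[a, b] (EFin \o h x).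
    by move=> _; exact: continuous_itv_integrable.
  have hder x y : `]r - 1, r + 1[ x -> `[a, b] y -> derivable (h ^~ y) x 1.
    by move=> _ _; have := hd y x.
  have mab : measurable (`[a, b] : set (measurableTypeR R)) by exact: measurable_itv.
  have M0 : forall y : R, 0 <= `|M| by move=> y.
  have Mint : mu.-integrable `[a, b] (EFin \o (fun=> `|M|)).
    by apply: continuous_itv_integrable => x; exact: cvg_cst.
  have Mub x y : `]r - 1, r + 1[ x -> `[a, b] y -> `|partial1of2 h x y| <= `|M|.
    rewrite /= in_itv /= => /andP[x1 x2] _; rewrite p1.
    apply: le_trans (ler_norm M); apply: HM.
    rewrite -[x](subrK r) addrC; apply: (le_trans (ler_normD _ _)).
    by rewrite lerD2l ler_distl (ltW x1) (ltW x2).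
  have der := derivable_under_integral mab Ir hint hder M0 Mint Mub.
  have := differentiation_under_integral mab Ir hint hder M0 Mint Mub.
  rewrite derive1E => dE; apply: DeriveDef; first exact: der.
  by rewrite [LHS]dE; apply: eq_Rintegral => t _; rewrite p1.
have cF : {within `[0, e], continuous F}.
  apply: continuous_subspaceT => r; have Fr := dF r.
  exact/differentiable_continuous/derivable1_diffP.
have [c] := MVT e0 (fun x _ => dF x) cF.
rewrite in_itv /= => /andP[c0 _]; rewrite dh0// mul0r => /eqP.
by rewrite subr_eq0 => /eqP.
Qed.

(** The mean value property.  For [g] the restriction of an entire function to
    polar coordinates, the angular derivative is [i r] times the radial one
    [dg].  The angular derivative integrates to zero over a period, hence so
    does the radial one, and the integral does not depend on the radius. *)
Lemma polar_mean_const (g dg : R -> R -> R[i]) (a b e : R) : 0 < e -> a < b ->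
  (forall t, Cderive (g ^~ t) (dg ^~ t)) ->
  (forall r, Cderive (g r) (fun t => 'i%C * r%:C%C * dg r t)) ->
  (forall r, exists d, Cderive (dg r) d) ->
  (forall r, g r a = g r b) ->
  (forall B : R, exists M : R, forall r t : R, `|r| <= B -> Cbounded M (dg r t)) ->
  Cintegral `[a, b] (g e) = Cintegral `[a, b] (g 0).
Proof.
move=> e0 ab dr dt dg' per bd.
have cg r := Cderive_continuous (dt r).
have dg0 r : 0 < r -> Cintegral `[a, b] (dg r) = 0.
  move=> r0; have ir0 : 'i%C * r%:C%C != 0 :> R[i].
    by rewrite mulf_neq0// eq_complex /= ?eqxx ?oner_eq0 ?(gt_eqF r0)// andbF.
  have [d dgd] := dg' r; apply: (mulfI ir0); rewrite mulr0 -CintegralZ; last 2 first.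
  - exact: measurable_itv.
  - exact: Cderive_integrable dgd.
  rewrite (Cintegral_derive ab (dt r) (CderiveM (Cderive_cst _) dgd)).
  by rewrite per subrr.
apply: complex_ext.
  apply: (@integral_const_of_derive0
    (fun r t => Re (g r t)) (fun r t => Re (dg r t))) => //.
  - by move=> t r; have [] := dr t r.
  - by move=> r; have [] := cg r.
  - by move=> r /dg0 /(congr1 (@complex.Re _)).
  - by move=> B; have [M HM] := bd B; exists M => r t rB; have [] := HM r t rB.
apply: (@integral_const_of_derive0
  (fun r t => Im (g r t)) (fun r t => Im (dg r t))) => //.
- by move=> t r; have [] := dr t r.
- by move=> r; have [] := cg r.
- by move=> r /dg0 /(congr1 (@complex.Im _)).
- by move=> B; have [M HM] := bd B; exists M => r t rB; have [] := HM r t rB.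
Qed.

End ComplexCalculus.

(** * Contour and Laplace moments *)

Section ContourMoments.
Import numFieldNormedType.Exports.
Variable R : realType.
Local Notation mu := (@lebesgue_measure R).
Local Open Scope classical_set_scope.

Lemma circleE (e t : R) : circle e t = ((e * cos t) +i* (e * sin t))%C.
Proof.
rewrite /circle /expC; apply: complex_ext => /=;
  by rewrite !(mul0r, mul1r, mulr0, subr0, sub0r, oppr0, expR0, addr0, add0r).
Qed.

Lemma circle_period (e : R) : circle e (2 * pi) = circle e 0.
Proof. by rewrite !circleE mulr_natl cos2pi sin2pi cos0 sin0. Qed.

Lemma circle_neq0 (e t : R) : 0 < e -> circle e t != 0.
Proof.
move=> e0; rewrite circleE; apply/eqP => -[/eqP + /eqP].
rewrite !mulf_eq0 !(gt_eqF e0)/= => /eqP c0 /eqP s0.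
have /eqP := cos2Dsin2 t; rewrite c0 s0 !expr0n /= addr0.
by rewrite eq_sym oner_eq0.
Qed.

Lemma circleV (e t : R) : 0 < e -> (circle e t)^-1 = circle e^-1 (- t).
Proof.
move=> e0; apply: (mulfI (circle_neq0 t e0)); rewrite mulfV ?circle_neq0//.
rewrite !circleE cosN sinN; apply: complex_ext; rewrite ?complex_ReM ?complex_ImM /=.
  by rewrite -(cos2Dsin2 t); field; rewrite gt_eqF.
by field; rewrite gt_eqF.
Qed.

Lemma circle_Cderive (e : R) : Cderive (circle e) (fun t => 'i%C * circle e t).
Proof.
have der := Cderive_exp (CderiveM (Cderive_cst 'i%C) (@Cderive_id R)).
apply: (eq_Cderive (CderiveM (Cderive_cst e%:C%C) der)) => t.
by rewrite /circle; ring.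
Qed.

Lemma circle_Cderive_radius (t : R) :
  Cderive (fun r : R => circle r t) (fun=> circle 1 t).
Proof.
have dw := Cderive_cst (expC ('i%C * t%:C%C)).
apply: (eq_Cderive (CderiveM (@Cderive_id R) dw)) => r.
by rewrite /circle; ring.
Qed.

Lemma circleV_Cderive (e : R) : 0 < e ->
  Cderive (fun t => (circle e t)^-1) (fun t => - 'i%C * (circle e t)^-1).
Proof.
move=> e0; rewrite (_ : (fun t => (circle e t)^-1) =
  fun t => (e^-1)%:C%C * expC (- 'i%C * t%:C%C)); last first.
  apply/funext => t; rewrite circleV//; congr (_ * expC _).
  by apply: complex_ext => /=; ring.
have der := Cderive_exp (CderiveM (Cderive_cst (- 'i%C)) (@Cderive_id R)).
apply: (eq_Cderive (CderiveM (Cderive_cst _) der)) => t.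
rewrite circleV// /circle.
have -> : - 'i%C * t%:C%C = 'i%C * (- t)%:C%C :> R[i] by apply: complex_ext => /=; ring.
by ring.
Qed.

Lemma circle_bounded (B r t : R) : `|r| <= B -> Cbounded B (circle r t).
Proof.
move=> rB; rewrite circleE; split; rewrite normrM -[leRHS]mulr1 ler_pM//.
  by rewrite ler_norml cos_geN1 cos_le1.
by rewrite ler_norml sin_geN1 sin_le1.
Qed.

Definition gaussC (x : R[i]) : R[i] := expC (x ^+ 2 / 2).

Lemma gaussC_Cderive (x x' : R -> R[i]) : Cderive x x' ->
  Cderive (fun t => gaussC (x t)) (fun t => x t * x' t * gaussC (x t)).
Proof.
move=> xx'; have := Cderive_exp (CderiveM (CderiveM xx' xx') (Cderive_cst 2^-1)).
by move=> /eq_Cderive; apply => t; rewrite /gaussC expr2; field.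
Qed.

Lemma gaussC_bounded (B : R) :
  exists M : R, forall z, Cbounded B z -> Cbounded M (gaussC z).
Proof.
eexists => z zB; apply: Cbounded_exp; rewrite expr2.
exact: (CboundedM (CboundedM zB zB) (Cbounded_self _)).
Qed.

(** Up to the factor [2 pi], the [n]-th Taylor coefficient of [gaussC] at [0]. *)
Definition contour_moment (e : R) (n : nat) : R[i] :=
  Cintegral `[0, 2 * pi] (fun t => gaussC (circle e t) * (circle e t)^-1 ^+ n).

Let pi2_gt0 : 0 < 2 * pi :> R. Proof. by rewrite mulr_gt0// pi_gt0. Qed.

(** In the angle, [x' = i x] and therefore [(exp (x^2 / 2))' = i x^2 exp (x^2 / 2)]
    and [(x^-n)' = - i n x^-n]. *)
Lemma contour_Cderive (e : R) n : 0 < e ->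
  Cderive (fun t => gaussC (circle e t) * (circle e t)^-1 ^+ n)
    (fun t => 'i%C *
      ((circle e t) ^+ 2 * (gaussC (circle e t) * (circle e t)^-1 ^+ n) +
       - n%:R * (gaussC (circle e t) * (circle e t)^-1 ^+ n))).
Proof.
move=> e0; have dE := gaussC_Cderive (circle_Cderive e).
apply: (eq_Cderive (CderiveM dE (CderiveX n (circleV_Cderive e0)))) => t.
by rewrite expr2; ring.
Qed.

Lemma contour_integrable (e : R) n : 0 < e ->
  Cintegrable `[0, 2 * pi] (fun t => gaussC (circle e t) * (circle e t)^-1 ^+ n).
Proof. by move=> e0; exact: Cderive_integrable (contour_Cderive n e0). Qed.

(** At radius [0] the function is the constant [1]. *)
Lemma mean_gaussC (e : R) : 0 < e ->
  Cintegral `[0, 2 * pi] (fun t => gaussC (circle e t)) = (2 * pi)%:C%C.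
Proof.
move=> e0; pose g (r t : R) := gaussC (circle r t).
have g0 : Cintegral `[0, 2 * pi] (g 0) = (2 * pi)%:C%C.
  have -> : g 0 = fun=> 1.
    by apply/funext => t; rewrite /g /gaussC /circle mul0r expr0n mul0r expC0.
  have cstE (c : R) : \int[mu]_(t in `[0, 2 * pi]) c = c * (2 * pi).
    rewrite Rintegral_cst; last exact: measurable_itv.
    have := @lebesgue_measure_itv R `[0, 2 * pi]%R.
    by rewrite /= lte_fin pi2_gt0 oppr0 addr0 => ->.
  by apply: complex_ext => /=; rewrite cstE ?mul1r ?mul0r.
rewrite -g0; have := @polar_mean_const R g
  (fun r t => circle r t * circle 1 t * g r t) 0 (2 * pi) e e0 pi2_gt0.
apply.
- by move=> t; exact: gaussC_Cderive (circle_Cderive_radius t).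
- move=> r; apply: (eq_Cderive (gaussC_Cderive (circle_Cderive r))) => t.
  by rewrite /g /circle; ring.
- move=> r; eexists; apply: CderiveM; last exact: gaussC_Cderive (circle_Cderive r).
  by apply: CderiveM; exact: circle_Cderive.
- by move=> r; rewrite /g circle_period.
- move=> B; have [M HM] := gaussC_bounded B; eexists => r t rB.
  apply: CboundedM; last exact: (HM _ (circle_bounded t rB)).
  apply: CboundedM; first exact: (circle_bounded t rB).
  by apply: (@circle_bounded 1); rewrite normr1.
Qed.

(** At radius [0] the function vanishes. *)
Lemma mean_id_gaussC (e : R) : 0 < e ->
  Cintegral `[0, 2 * pi] (fun t => circle e t * gaussC (circle e t)) = 0.
Proof.
move=> e0; pose g (r t : R) := circle r t * gaussC (circle r t).
have g0 : Cintegral `[0, 2 * pi] (g 0) = 0.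
  have -> : g 0 = fun=> 0 by apply/funext => t; rewrite /g /circle !mul0r.
  exact: Cintegral0.
rewrite -g0; have := @polar_mean_const R g (fun r t => circle 1 t *
  (1 + circle r t * circle r t) * gaussC (circle r t)) 0 (2 * pi) e e0 pi2_gt0.
apply.
- move=> t; have dx := circle_Cderive_radius t.
  by apply: (eq_Cderive (CderiveM dx (gaussC_Cderive dx))) => r; ring.
- move=> r; have dx := circle_Cderive r.
  apply: (eq_Cderive (CderiveM dx (gaussC_Cderive dx))) => t.
  by rewrite /g /circle; ring.
- move=> r; have dx := circle_Cderive r; eexists.
  apply: CderiveM; last exact: gaussC_Cderive dx.
  apply: CderiveM; first exact: circle_Cderive.
  by apply: CderiveD; [exact: Cderive_cst|exact: (CderiveM dx dx)].
- by move=> r; rewrite /g circle_period.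
- move=> B; have [M HM] := gaussC_bounded B; eexists => r t rB.
  apply: CboundedM; last exact: (HM _ (circle_bounded t rB)).
  apply: CboundedM; first by apply: (@circle_bounded 1); rewrite normr1.
  apply: CboundedD; first exact: Cbounded_self.
  exact: (CboundedM (circle_bounded t rB) (circle_bounded t rB)).
Qed.

(** The integral over a full turn of the derivative in [contour_Cderive] is
    zero. *)
Lemma contour_parts (e : R) n : 0 < e ->
  Cintegral `[0, 2 * pi] (fun t => (circle e t) ^+ 2 *
    (gaussC (circle e t) * (circle e t)^-1 ^+ n)) = n%:R * contour_moment e n.
Proof.
move=> e0; have dB := contour_Cderive n e0.
have dA := CderiveM (CderiveX 2 (circle_Cderive e)) dB.
have dnB := CderiveM (Cderive_cst (- n%:R)) dB.
have := Cintegral_derive pi2_gt0 dB (CderiveM (Cderive_cst 'i%C) (CderiveD dA dnB)).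
have mI : measurable (`[0, 2 * pi] : set (measurableTypeR R)) by exact: measurable_itv.
have iA := Cderive_integrable 0 (2 * pi) dA.
have inB := Cderive_integrable 0 (2 * pi) dnB.
rewrite circle_period subrr CintegralZ//; last exact: CintegrableD.
rewrite CintegralD// CintegralZ//; last exact: contour_integrable.
rewrite -/(contour_moment e n) mulNr => /eqP; rewrite mulf_eq0 => /orP[|].
  by rewrite eq_complex /= oner_eq0 andbF.
by rewrite subr_eq0 => /eqP.
Qed.

(** Both sides satisfy the same two-step recurrence: [contour_parts] at [n + 2]
    reads [J_n = (n + 2) J_(n+2)] for the contour moments [J], and at [n = 1] it
    reduces [J_1] to [mean_id_gaussC]. *)
Lemma contour_momentE (e : R) n : 0 < e ->
  n`!%:R * contour_moment e n = (2 * pi)%:C%C * (matching_number n)%:R.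
Proof.
move=> e0; have V t : circle e t * (circle e t)^-1 = 1 by rewrite mulfV// circle_neq0.
suff [] : n`!%:R * contour_moment e n = (2 * pi)%:C%C * (matching_number n)%:R /\
  n.+1`!%:R * contour_moment e n.+1 = (2 * pi)%:C%C * (matching_number n.+1)%:R by [].
elim: n => [|n [IH1 IH2]]; split=> //.
- rewrite mulr1 mul1r -(mean_gaussC e0); apply: eq_Cintegral => t _.
  by rewrite expr0 mulr1.
- rewrite mulr0 -(contour_parts 1 e0) -(mean_id_gaussC e0).
  apply: eq_Cintegral => t _; rewrite expr1 expr2.
  set x := circle e t; set y := x^-1; have xy : x * y = 1 := V t.
  transitivity ((x * y) * (x * gaussC x)); first by ring.
  by rewrite xy mul1r.
- rewrite factS mulnC natrM -mulrA -contour_parts//.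
  have -> : Cintegral `[0, 2 * pi] (fun t => (circle e t) ^+ 2 *
    (gaussC (circle e t) * (circle e t)^-1 ^+ n.+2)) = contour_moment e n.
    apply: eq_Cintegral => t _; rewrite expr2 !exprS.
    set x := circle e t; set y := x^-1; have xy : x * y = 1 := V t.
    transitivity ((x * y) * (x * y) * (gaussC x * y ^+ n)); first by ring.
    by rewrite xy !mul1r.
  by rewrite factS natrM -mulrA IH1 /= natrM; ring.
Qed.

(** The primitive of [t^k exp (- t)] that vanishes at infinity, obtained by
    repeated integration by parts. *)
Fixpoint laplace_primitive (k : nat) (t : R) : R :=
  if k is j.+1 then k%:R * laplace_primitive j t - t ^+ k * expR (- t)
  else - expR (- t).

Lemma is_derive_laplace_primitive k (t : R) :
  is_derive t 1 (laplace_primitive k) (t ^+ k * expR (- t)).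
Proof.
elim: k => [|k IH].
  rewrite (_ : laplace_primitive 0 = - (expR \o -%R)) //.
  by apply: is_derive_eq; rewrite /GRing.scale /=; ring.
have dE : is_derive t 1 (expR \o -%R : R -> R) (- expR (- t)).
  by apply: is_derive_eq; rewrite /GRing.scale /=; ring.
have dX : is_derive t 1 ((fun u : R => u) ^+ k.+1) (k.+1%:R * t ^+ k).
  by apply: is_derive_eq; rewrite /GRing.scale /= mulr1.
rewrite (_ : laplace_primitive k.+1 = k.+1%:R \*: laplace_primitive k -
   (fun u : R => u) ^+ k.+1 * (expR \o -%R)); last first.
  by apply/funext => u; rewrite exprfctE.
apply: (is_derive_eq (is_deriveB (is_deriveZ k.+1%:R IH) (is_deriveM dX dE))).
rewrite exprfctE exprS /GRing.scale /=.
by set a := t ^+ k; ring.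
Qed.

Lemma laplace_primitive0 k : laplace_primitive k 0 = - k`!%:R.
Proof.
elim: k => [|k IH] /=; first by rewrite oppr0 expR0.
by rewrite IH expr0n /= mul0r subr0 factS natrM mulrN.
Qed.

(** [exp t] dominates its Taylor term [t^(k+1) / (k+1)!], so that the product is
    at most [(k+1)! / t]. *)
Lemma cvg_pow_expRN k : (t ^+ k * expR (- t) : R) @[t --> +oo] --> 0.
Proof.
apply/cvgrPdist_le => e e0; near=> t.
have t0 : 0 < t by near: t; apply: nbhs_pinfty_gt; exact: num_real.
have tk : k.+1`!%:R / e <= t by near: t; apply: nbhs_pinfty_ge; exact: num_real.
rewrite sub0r normrN ger0_norm ?mulr_ge0 ?exprn_ge0 ?expR_ge0 ?(ltW t0)//.
have f0 : 0 < k.+1`!%:R :> R by rewrite ltr0n fact_gt0.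
have := expR_ge1Dxn k (ltW t0); set E := expR t => hE.
have {}hE : t ^+ k.+1 / k.+1`!%:R <= E by apply: le_trans hE; rewrite lerDr.
have E0 : 0 < E by exact: expR_gt0.
rewrite expRN -/E ler_pdivrMr//; apply: le_trans (ler_wpM2l (ltW e0) hE).
have -> : e * (t ^+ k.+1 / k.+1`!%:R) = t ^+ k * (t / (k.+1`!%:R / e)).
  rewrite exprS; move: f0 => /gt_eqF f0; set f : R := k.+1`!%:R in f0 *.
  by set a := t ^+ k; field; rewrite f0 (gt_eqF e0).
by rewrite ler_peMr ?exprn_ge0 ?(ltW t0)// ler_pdivlMr ?divr_gt0// mul1r.
Unshelve. all: end_near. Qed.

Lemma cvg_laplace_primitive k : laplace_primitive k t @[t --> +oo] --> 0.
Proof.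
elim: k => [|k IH] /=.
  by rewrite -oppr0; apply: cvgN; exact: cvgr_expR.
rewrite -[X in _ --> X]subr0 -[X in _ --> X - _](mulr0 k.+1%:R); apply: cvgB.
  by apply: cvgM => //; exact: cvg_cst.
exact: cvg_pow_expRN.
Qed.

Lemma laplace_power k :
  mu.-integrable `]0, +oo[ (fun t => (t ^+ k * expR (- t))%:E) /\
  \int[mu]_(t in `]0, +oo[) (t ^+ k * expR (- t)) = k`!%:R.
Proof.
pose h (t : R) := t ^+ k * expR (- t).
have ch : continuous h.
  rewrite (_ : h = (fun u : R => u) ^+ k * (expR \o -%R)); last first.
    by apply/funext => u; rewrite exprfctE.
  move=> t; apply/differentiable_continuous/derivable1_diffP.
  exact: ex_derive.
have int_h : (\int[mu]_(t in [set` `]0%R, +oo[%R]) (h t)%:E)%E = k`!%:R%:E.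
  rewrite integral_itv_obnd_cbnd; last first.
    apply/measurable_EFinP; apply: measurable_funTS.
    exact: continuous_measurable_fun.
  rewrite (@ge0_continuous_FTC2y _ h (laplace_primitive k) 0 0).
  - by rewrite laplace_primitive0 -EFinB opprK add0r.
  - by move=> t t0; rewrite mulr_ge0 ?exprn_ge0 ?expR_ge0.
  - exact: continuous_subspaceT.
  - exact: cvg_laplace_primitive.
  - by move=> t _; have := is_derive_laplace_primitive k t.
  - apply: cvg_at_right_filter; have := is_derive_laplace_primitive k 0 => ?.
    exact/differentiable_continuous/derivable1_diffP.
  - move=> t _; have := is_derive_laplace_primitive k t => ?.
    by rewrite derive1E derive_val.
split; last by rewrite /Rintegral int_h.
apply/integrableP; split.
  apply/measurable_EFinP; apply: measurable_funTS.
  exact: continuous_measurable_fun.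
have := ltry (k`!%:R : R); rewrite -int_h; congr (_ < _)%E; apply: eq_integral => t.
rewrite inE /= in_itv /= andbT => t0; rewrite ger0_norm//.
by rewrite mulr_ge0 ?exprn_ge0 ?expR_ge0// ltW.
Qed.

End ContourMoments.

(** * The integral representation *)

Lemma bubble_coef_horner (K : comNzRingType) (s : K) m p :
  bubble_coef s m p = (bubble_coef 'X m p).[s].
Proof.
rewrite horner_sum; apply: eq_bigr => b _; rewrite !hornerM.
have flankX n : (flank 'X n).[s] = flank s n.
  by case: n => [|[|n]] /=; rewrite ?hornerC// hornerXn.
have chebX n : (chebU 'X n).[s] = chebU s n.
  rewrite -{2}(hornerX s).
  rewrite (@chebU_morph _ _ (fun q : {poly K} => q.[s]))//; first exact: hornerC.
    by move=> q r; rewrite hornerM.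
  by move=> q r; rewrite hornerD hornerN.
by rewrite !flankX chebX.
Qed.

Section Transform.
Variables (R : realType) (e : R).
Hypothesis e0 : 0 < e.

(** The factor [i x] of the pullback cancels the [1 / x] of the integrand. *)
Lemma circle_pullbackE m p (t theta : R) : 0 < t ->
  circle_pullback e (contour_integrand m p t) theta =
  \sum_(k < size (bubble_coef ('X : {poly R[i]}) m p))
    ('i%C * ((bubble_coef 'X m p)`_k * t%:C%C ^+ k)) *
    (gaussC (circle e theta) * (circle e theta)^-1 ^+ k).
Proof.
move=> t0; rewrite /circle_pullback /contour_integrand /calL_at.
set x := circle e theta; have x0 : x != 0 by exact: circle_neq0.
have t0' : t%:C%C != 0 :> R[i] by rewrite eq_complex /= eqxx andbT gt_eqF.
rewrite calL_fps_coef; last first.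
  by rewrite -exprMn mulrA divfK// mulfK// sqr_i.
rewrite bubble_coef_horner horner_coef -/(gaussC x).
transitivity ('i%C * gaussC x * \sum_(k < size (bubble_coef ('X : {poly R[i]}) m p))
    (bubble_coef 'X m p)`_k * (t%:C%C / x) ^+ k).
  by set S := \sum_(k < _) _; field.
rewrite mulr_sumr; apply: eq_bigr => k _; rewrite exprMn.
by set a := t%:C%C ^+ k; set b := x^-1 ^+ k; ring.
Qed.

Let mI : measurable (`[0, 2 * pi]%classic : set (measurableTypeR R)).
Proof. exact: measurable_itv. Qed.
Let mP : measurable (`]0, +oo[%classic : set (measurableTypeR R)).
Proof. exact: measurable_itv. Qed.

Lemma circle_pullback_integrable m p (t : R) : 0 < t ->
  Cintegrable `[0, 2 * pi]%classic (circle_pullback e (contour_integrand m p t)).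
Proof.
move=> t0.
apply: (eq_Cintegrable mI (fun theta _ => esym (circle_pullbackE m p theta t0))).
apply: (@Cintegrable_sum R _ _ (fun k theta =>
   'i%C * ((bubble_coef 'X m p)`_k * t%:C%C ^+ k) *
   (gaussC (circle e theta) * (circle e theta)^-1 ^+ k))) => // k.
by apply: CintegrableZ => //; exact: contour_integrable.
Qed.

(** The contour integral selects Taylor coefficients: [x^-k] contributes
    [matching_number k / k!], which is [1 / (2^j j!)] for [k = 2 j]. *)
Lemma laplace_integrandE m p (t : R) : 0 < t ->
  laplace_integrand e m p t =
  \sum_(k < size (bubble_coef ('X : {poly R[i]}) m p))
    ((bubble_coef 'X m p)`_k * (matching_number k)%:R / k`!%:R) *
    (t ^+ k * expR (- t))%:C%C.
Proof.
move=> t0; rewrite /laplace_integrand /circle_integral.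
rewrite (eq_Cintegral (fun theta _ => circle_pullbackE m p theta t0)).
rewrite (@Cintegral_sum R _ _ (fun k theta =>
   'i%C * ((bubble_coef 'X m p)`_k * t%:C%C ^+ k) *
   (gaussC (circle e theta) * (circle e theta)^-1 ^+ k))) => //; last first.
  by move=> k; apply: CintegrableZ => //; exact: contour_integrable.
rewrite !mulr_sumr; apply: eq_bigr => k _.
rewrite CintegralZ//; last exact: contour_integrable.
rewrite -/(contour_moment e k).
have k0 : k`!%:R != 0 :> R[i] by rewrite pnatr_eq0 -lt0n fact_gt0.
have pi0 : (pi : R)%:C%C != 0 :> R[i].
  by rewrite eq_complex /= eqxx andbT gt_eqF// pi_gt0.
have i0 : 'i%C != 0 :> R[i] by rewrite eq_complex /= oner_eq0 andbF.
have -> : contour_moment e k = (2 * (pi : R)%:C%C) * (matching_number k)%:R / k`!%:R.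
  apply: (mulfI k0); rewrite contour_momentE// rmorphM rmorph_nat.
  by field.
rewrite rmorphM rmorphXn /=.
move: pi0 i0; move: 'i%C (pi : R)%:C%C => i q q0 i0.
set a := t%:C%C ^+ k; set E := (expR (- t))%:C%C; set P := _`_k.
set f : R[i] := k`!%:R in k0 *.
by set mk : R[i] := _%:R; field; rewrite k0 q0 i0.
Qed.

Let power_integrable k : Cintegrable `]0, +oo[%classic
  (fun t : R => (t ^+ k * expR (- t))%:C%C).
Proof.
by split; [exact: (laplace_power R k).1|exact: integrable0].
Qed.

Lemma laplace_integrand_integrable m p :
  Cintegrable `]0, +oo[%classic (laplace_integrand e m p).
Proof.
apply: (@eq_Cintegrable R _ (fun t =>
  \sum_(k < size (bubble_coef ('X : {poly R[i]}) m p))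
    ((bubble_coef 'X m p)`_k * (matching_number k)%:R / k`!%:R) *
    (t ^+ k * expR (- t))%:C%C)) => //.
  by move=> t; rewrite /= in_itv /= andbT => t0; rewrite laplace_integrandE.
apply: (@Cintegrable_sum R _ _ (fun k t =>
  ((bubble_coef 'X m p)`_k * (matching_number k)%:R / k`!%:R) *
  (t ^+ k * expR (- t))%:C%C)) => // k.
exact: CintegrableZ.
Qed.

(** The [k!] of the Laplace integral cancels the denominator of the Taylor
    coefficient and leaves the number of matchings. *)
Lemma laplace_integral_moment m p :
  Cintegral `]0, +oo[%classic (laplace_integrand e m p) =
  moment (bubble_coef 'X m p).
Proof.
rewrite (@eq_Cintegral R _ _ (fun t =>
  \sum_(k < size (bubble_coef ('X : {poly R[i]}) m p))
    ((bubble_coef 'X m p)`_k * (matching_number k)%:R / k`!%:R) *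
    (t ^+ k * expR (- t))%:C%C)); last first.
  by move=> t; rewrite /= in_itv /= andbT => t0; rewrite laplace_integrandE.
rewrite (@Cintegral_sum R _ _ (fun k t =>
  ((bubble_coef 'X m p)`_k * (matching_number k)%:R / k`!%:R) *
  (t ^+ k * expR (- t))%:C%C)) => //; last by move=> k; exact: CintegrableZ.
apply: eq_bigr => k _; rewrite CintegralZ//.
have -> : Cintegral `]0, +oo[%classic (fun t : R => (t ^+ k * expR (- t))%:C%C) = k`!%:R.
  rewrite -(rmorph_nat (real_complex R)) -(laplace_power R k).2.
  by apply: complex_ext => //=; rewrite /Rintegral integral0.
by rewrite divfK// pnatr_eq0 -lt0n fact_gt0.
Qed.

End Transform.

Lemma bubble_count_moment (K : comNzRingType) n p :
  (bubble_count n p)%:R = moment (bubble_coef 'X (2 * n) p) :> K.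
Proof. exact: sum_bubbles_size. Qed.

(** An odd number of points has no perfect matching. *)
Lemma moment_bubble_coef_odd (K : comNzRingType) m p :
  odd m -> moment (bubble_coef 'X m p) = 0 :> K.
Proof.
move=> mo; rewrite -sum_bubbles_size big_pred0// => D.
have mu_odd k : odd k -> matching_number k = 0%N.
  have [j] := ubnP k; elim: j k => // j IH [|[|k]] //; rewrite ltnS => kj /= ok.
  by rewrite IH ?muln0 ?(ltnW kj)//; move: ok; rewrite negbK.
have /eqP := card_matchings [set: 'I_m].
rewrite cardsT card_ord mu_odd// cards_eq0 => /eqP ->.
by rewrite inE.
Qed.

Lemma bubble_coef_eq0 (K : comNzRingType) m p : ~~ (0 < p <= m)%N ->
  bubble_coef 'X m p = 0 :> {poly K}.
Proof.
move=> pm; rewrite /bubble_coef big_pred0// => b; apply: contraNF pm => /andP[-> pb] /=.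
by rewrite (leq_trans pb)// -ltnS.
Qed.

Theorem theorem1 (R : realType) (e : R) (he : 0 < e) :
  let B : fps (fps R[i]) := fps2_of (fun n p => (bubble_count n p)%:R) in
  let B' : fps (fps R[i]) :=
    fps2_of (fun n p => if (1 <= n)%N && (1 <= p <= 2 * n)%N
                        then (bubble_count n p)%:R else 0) in
  (forall (m p : nat) (t : R), 0 < t ->
     Cintegrable `[0, 2 * pi]%classic
       (circle_pullback e (contour_integrand m p t))) /\
  (forall m p : nat,
     Cintegrable `]0, +oo[%classic (laplace_integrand e m p)) /\
  fps_subst_sqr B = fps_subst_sqr B' /\
  fps_subst_sqr B = integral_series e.
Proof.
move=> B B'; split; first by move=> m p t; exact: circle_pullback_integrable.
split; first by move=> m p; exact: laplace_integrand_integrable.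
split.
  congr fps_subst_sqr; apply/fpsP => n; apply/fpsP => p /=; case: ifPn => // np.
  rewrite bubble_count_moment bubble_coef_eq0 ?moment0//.
  by apply: contra np => /andP[p0 pn]; rewrite p0 pn !andbT; lia.
apply/fpsP => m; apply/fpsP => p.
rewrite [RHS]/= laplace_integral_moment// /fps_subst_sqr /=; case: ifPn => mo.
  by rewrite moment_bubble_coef_odd.
rewrite -[LHS]/((bubble_count m./2 p)%:R : R[i]) bubble_count_moment.
by rewrite mul2n even_halfK.
Qed.
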